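(* Let $K$ be a trivially valued algebraically closed field and let $\mathcal{B}=\{C_1,\dots,C_n\}$ be a transverse very affine arrangement of curves in the projective plane $\mathbb{P}^2_K$. Let $X_{\mathcal{B}}=\mathbb{P}^2_K\setminus\bigcup_{C\in\mathcal{B}}C$ be its complement, viewed as a closed subvariety of its intrinsic torus. Then the tropicalization $\mathrm{trop}(X_{\mathcal{B}})$ is supported on the arroid fan $\Sigma_{\mathbf{A}_{\mathcal{B}}}$ of the associated transversal arroid $\mathbf{A}_{\mathcal{B}}$; that is, $\mathrm{trop}(X_{\mathcal{B}})$ equals the support $|\Sigma_{\mathbf{A}_{\mathcal{B}}}|$.
   Context: **Arrangements.** An arrangement of curves is a finite set of distinct irreducible curves $C_1,\dots,C_n$ in $\mathbb{P}^2_K$, $C_i$ of degree $d_i$ with equation $f_i=0$. It is very affine if it contains at least three lines intersecting generically (i.e. three lines with no common point, so that they can be mapped to the coordinate axes). It is transverse if all the curves intersect pairwise transversely (all pairwise intersection multiplicities are $1$). **Intrinsic torus.** For a very affine variety $X$, the intrinsic torus is $\mathbf{T}_X=\mathrm{Hom}(\mathcal{O}(X)^*/K^*,K^* )$, with character lattice $M=\mathcal{O}(X)^*/K^*$ and $N=\mathrm{Hom}(M,\mathbb{Z})$. The choice of a splitting gives a closed embedding $X\to\mathbf{T}_X$, and $\mathrm{trop}(X)\subset N_{\mathbb{R}}$ is the tropicalization with respect to this embedding. For $X=X_{\mathcal{B}}$, $M$ is identified with $\{a\in\mathbb{Z}^n\mid\sum a_id_i=0\}$ via $a\mapsto\prod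 f_i^{a_i}$, so $N_{\mathbb{R}}=\mathbb{R}^n/\langle(d_1,\dots,d_n)\rangle$. **Arroid of the arrangement and its fan.** The transversal arroid $\mathbf{A}_{\mathcal{B}}$ (of rank two) has ground set $\mathcal{A}=\{1,\dots,n\}$, degrees $d_i=\deg C_i$, and as multiset of points $\mathcal{P}$ the multiset having one element $\mathbf{p}_x=\{i\mid x\in C_i\}\subseteq\mathcal{A}$ for each point $x\in\mathbb{P}^2_K$ lying on at least two curves of $\mathcal{B}$; all its intersection multiplicity functions $m_{\mathbf{p}}:\mathbf{p}^2\to\mathbb{Z}$ are constant equal to $1$. Let $\mathcal{P}^u$ be the underlying set of $\mathcal{P}$, $[e_i]$ the class of the standard basis vector $e_i$ in $\mathbb{R}^n/\langle(d_1,\dots,d_n)\rangle$, and $v_{\mathbf{p}}=\sum_{j\in\mathbf{p}}[e_j]$. The arroid fan $\Sigma_{\mathbf{A}_{\mathcal{B}}}\subset\mathbb{R}^n/\langle(d_1,\dots,d_n)\rangle$ consists of the origin, the rays $\rho_i=\mathrm{cone}([e_i])$ ($i\in\mathcal{A}$), the rays $\rho_{\mathbf{p}}=\mathrm{cone}(v_{\mathbf{p}})$ ($\mathbf{p}\in\mathcal{P}^u$), and the two-dimensional cones $\sigma_{i,\mathbf{p}}=\mathrm{cone}(\rho_i,\rho_{\mathbf{p}})$ for $\mathbf{p}\in\mathcal{P}^u$, $i\in\mathbf{p}$ (with weight the number of times $\mathbf{p}$ occurs in $\mathcal{P}$). *)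

(* Defs.v *)
From HB Require Import structures.
From mathcomp Require Import all_boot all_order all_algebra.
From mathcomp Require Import freeg mpoly.
From mathcomp Require Import reals.

Set Implicit Arguments.
Unset Strict Implicit.
Unset Printing Implicit Defensive.

Import Order.TTheory GRing.Theory Num.Theory.
Local Open Scope ring_scope.
Local Open Scope quotient_scope.

(* A point of P^2_K is a line through the origin of K^3. *)
Definition proj_plane (K : fieldType) : Type :=
  {L : {vspace 'rV[K]_3} | \dim L == 1%N}.

(* A choice of homogeneous coordinates.  It is only used where the result does
   not depend on it: for (non)vanishing of homogeneous polynomials and for
   degree-0 products of their values. *)
Definition hcoord (K : fieldType) (x : proj_plane K) : 'I_3 -> K :=
  fun k => vpick (val x) 0 k.

Definition on_curve (K : fieldType) (f : {mpoly K[3]}) (x : proj_plane K) :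
  bool := f.@[hcoord x] == 0.

(* The local ring O_{P^2,x}, inside the fraction field of K[x_0, x_1, x_2]. *)
Definition local_ring (K : fieldType) (x : proj_plane K)
    (u : {fraction {mpoly K[3]}}) : Prop :=
  exists (e : nat) (a s : {mpoly K[3]}),
    [/\ a \is e.-homog, s \is e.-homog, s.@[hcoord x] != 0
      & u = tofrac a / tofrac s].

(* Local equations f / h at x of the curve f = 0; two of them differ by a unit
   of the local ring. *)
Definition local_equation (K : fieldType) (x : proj_plane K) (f : {mpoly K[3]})
    (u : {fraction {mpoly K[3]}}) : Prop :=
  exists (e : nat) (h : {mpoly K[3]}),
    [/\ f \is e.-homog, h \is e.-homog, h.@[hcoord x] != 0
      & u = tofrac f / tofrac h].

(* The ideal generated in O_{P^2,x} by local equations of f = 0 and g = 0. *)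
Definition local_ideal (K : fieldType) (x : proj_plane K)
    (f g : {mpoly K[3]}) (u : {fraction {mpoly K[3]}}) : Prop :=
  exists a b f' g' : {fraction {mpoly K[3]}},
    [/\ local_ring x a, local_ring x b, local_equation x f f',
        local_equation x g g' & u = a * f' + b * g'].

(* dim_K O_{P^2,x} / (f, g) = m : the classes of b_0, ..., b_{m-1} form a basis
   of the quotient. *)
Definition intersection_multiplicity (K : fieldType) (x : proj_plane K)
    (f g : {mpoly K[3]}) (m : nat) : Prop :=
  exists b : 'I_m -> {fraction {mpoly K[3]}},
    (forall k, local_ring x (b k)) /\
    (forall u, local_ring x u ->
       exists! c : {ffun 'I_m -> K},
         local_ideal x f g (u - \sum_(k < m) tofrac (c k)%:MP * b k)).

Definition mpoly_irreducible (K : fieldType) (p : {mpoly K[3]}) : Prop :=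
  [/\ p != 0, p \isn't a GRing.unit
    & forall g h : {mpoly K[3]},
        p = g * h -> g \is a GRing.unit \/ h \is a GRing.unit].

Record arrangement (K : fieldType) (n : nat) : Type := Arrangement {
  eqn : 'I_n -> {mpoly K[3]};
  deg : 'I_n -> nat;
  eqn_homog : forall i, eqn i \is (deg i).-homog;
  eqn_irreducible : forall i, mpoly_irreducible (eqn i);
  curves_distinct : forall i j,
    (forall x, on_curve (eqn i) x = on_curve (eqn j) x) -> i = j
}.

Definition very_affine (K : fieldType) (n : nat) (B : arrangement K n) : Prop :=
  exists i j k : 'I_n,
    [/\ uniq [:: i; j; k], deg B i = 1%N, deg B j = 1%N, deg B k = 1%N
      & forall x, ~~ [&& on_curve (eqn B i) x, on_curve (eqn B j) x
                       & on_curve (eqn B k) x]].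

Definition transverse (K : fieldType) (n : nat) (B : arrangement K n) : Prop :=
  forall (i j : 'I_n) (x : proj_plane K), i != j ->
    on_curve (eqn B i) x -> on_curve (eqn B j) x ->
    intersection_multiplicity x (eqn B i) (eqn B j) 1.

Definition in_complement (K : fieldType) (n : nat) (B : arrangement K n)
    (x : proj_plane K) : Prop := forall i, ~~ on_curve (eqn B i) x.

(* M is the character lattice of the torus Hom(M, K^* ), {freeg M / K} the
   K-module underlying the ring K[M] of Laurent polynomials.  K being algebraically closed, a closed subvariety is
   given by its set Y of K-points, each seen as a map M -> K, and its ideal is
   the ideal of Laurent polynomials vanishing on Y. *)
Definition vanishes_on (K : fieldType) (M : choiceType) (Y : (M -> K) -> Prop)
    (g : {freeg M / K}) : Prop :=
  forall t, Y t -> \sum_(a <- dom g) coeff a g * t a = 0.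

(* The minimum over the support of g of val (g_a) + <a, w> is attained at least
   twice (min convention); the zero Laurent polynomial imposes no condition.
   The valuation val : K -> R is only used on nonzero scalars. *)
Definition min_attained_twice (K : fieldType) (R : realType) (val : K -> R)
    (M : choiceType) (w : M -> R) (g : {freeg M / K}) : Prop :=
  g = 0 \/
  exists a b : M,
    [/\ a \in dom g, b \in dom g, a != b,
        val (coeff a g) + w a = val (coeff b g) + w b
      & forall c, c \in dom g -> val (coeff a g) + w a <= val (coeff c g) + w c].

Definition trop (K : fieldType) (R : realType) (val : K -> R)
    (M : choiceType) (Y : (M -> K) -> Prop) (w : M -> R) : Prop :=
  forall g, vanishes_on Y g -> min_attained_twice val w g.

Definition trivial_valuation (K : fieldType) (R : realType) : K -> R :=
  fun _ => 0.
Arguments trivial_valuation : clear implicits.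

Definition degree_line (R : realType) (n : nat) (d : 'I_n -> nat) :
  {vspace 'rV[R]_n} := <[\row_i (d i)%:R]>%VS.

Definition N_space (R : realType) (n : nat) (d : 'I_n -> nat) : Type :=
  {ideal_quot degree_line R d}.

Definition N_class (R : realType) (n : nat) (d : 'I_n -> nat) (v : 'rV[R]_n) :
  N_space R d := \pi_({ideal_quot degree_line R d}) v.

(* M = {a in Z^n | sum_i a_i d_i = 0} *)
Definition M_lattice (n : nat) (d : 'I_n -> nat) : choiceType :=
  {a : 'rV[int]_n | \sum_i a 0 i * (d i)%:Z == 0}.

(* The value does not depend on the representative of w, since sum_i a_i d_i = 0. *)
Definition pairing (R : realType) (n : nat) (d : 'I_n -> nat)
    (w : N_space R d) (a : M_lattice d) : R :=
  \sum_i (val a 0 i)%:~R * (repr w : 'rV[R]_n) 0 i.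

(* The embedding x |-> (a |-> prod_i f_i(x) ^ a_i), for the splitting
   a |-> prod_i f_i ^ a_i of O(X)^* -> O(X)^* / K^* = M. *)
Definition intrinsic_embedding (K : fieldType) (n : nat) (B : arrangement K n)
    (x : proj_plane K) : M_lattice (deg B) -> K :=
  fun a => \prod_i (eqn B i).@[hcoord x] ^ (val a 0 i).
Arguments intrinsic_embedding {K n} B x a.

Definition embedded_complement (K : fieldType) (n : nat) (B : arrangement K n)
    (t : M_lattice (deg B) -> K) : Prop :=
  exists2 x, in_complement B x & t = intrinsic_embedding B x.
Arguments embedded_complement {K n} B t.

Definition trop_complement (K : fieldType) (R : realType) (n : nat)
    (B : arrangement K n) (w : N_space R (deg B)) : Prop :=
  trop (trivial_valuation K R) (embedded_complement B) (pairing w).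
Arguments trop_complement {K R n} B w.

(* The multiset of points is a family of subsets of the ground set, and only the
   values of arr_mult p on arr_pt p x arr_pt p are meaningful. *)
Record arroid (n : nat) : Type := Arroid {
  arr_deg : 'I_n -> nat;
  arr_index : Type;
  arr_pt : arr_index -> {set 'I_n};
  arr_mult : arr_index -> 'I_n -> 'I_n -> int
}.

Definition curves_through (K : fieldType) (n : nat) (B : arrangement K n)
    (x : proj_plane K) : {set 'I_n} := [set i | on_curve (eqn B i) x].

Definition transversal_arroid (K : fieldType) (n : nat) (B : arrangement K n) :
    arroid n :=
  {| arr_deg := deg B;
     arr_index := {x : proj_plane K | (2 <= #|curves_through B x|)%N};
     arr_pt := fun x => curves_through B (proj1_sig x);
     arr_mult := fun _ _ _ => 1 |}.

Definition underlying_point (n : nat) (A : arroid n) (p : {set 'I_n}) : Prop :=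
  exists q : arr_index A, arr_pt q = p.

Definition unit_vec (R : realType) (n : nat) (i : 'I_n) : 'rV[R]_n :=
  delta_mx 0 i.

Definition point_vec (R : realType) (n : nat) (p : {set 'I_n}) : 'rV[R]_n :=
  \sum_(j in p) unit_vec R j.

(* The cone in R^n / <d> spanned by the classes of u and v. *)
Definition cone2 (R : realType) (n : nat) (d : 'I_n -> nat) (u v : 'rV[R]_n)
    (w : N_space R d) : Prop :=
  exists s t : R, [/\ 0 <= s, 0 <= t & w = N_class d (s *: u + t *: v)].

Definition cone1 (R : realType) (n : nat) (d : 'I_n -> nat) (u : 'rV[R]_n)
    (w : N_space R d) : Prop :=
  exists2 s : R, 0 <= s & w = N_class d (s *: u).

(* The weights of the maximal cones play no role in the support and are left
   out. *)
Inductive arroid_fan (R : realType) (n : nat) (A : arroid n) :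
    (N_space R (arr_deg A) -> Prop) -> Prop :=
| Fan_origin : arroid_fan (fun w => w = N_class (arr_deg A) 0)
| Fan_ray (i : 'I_n) : arroid_fan (cone1 (unit_vec R i))
| Fan_point_ray (p : {set 'I_n}) :
    underlying_point A p -> arroid_fan (cone1 (point_vec R p))
| Fan_cone (i : 'I_n) (p : {set 'I_n}) :
    underlying_point A p -> i \in p ->
    arroid_fan (cone2 (unit_vec R i) (point_vec R p)).

Arguments arroid_fan {R n} A C.

Definition fan_support (T : Type) (F : (T -> Prop) -> Prop) (w : T) : Prop :=
  exists2 C, F C & C w.

(* Main.v *)
(** A weight w lies in the tropicalization exactly when no relation
    sum_a c_a prod_i f_i^a_i = 0 has a unique term of minimal w-weight.

    If w is tropical, shift it along (d_1, ..., d_n) so that the three coordinate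
    lines get weights >= 0 with minimum 0.  Then all weights are >= 0.  Put
    Z = {i | w_i > 0}.  By the Nullstellensatz applied to the ideal (f_i, i in Z)
    and to prod_{l notin Z} f_l there is a point x lying on exactly the curves of Z.
    If w_k < w_i, w_j for i, j, k in Z, the same argument applies to the ideal of
    all h such that h f_k is a combination of monomials of weight > w_k; at the
    point x it yields, transversality gives S f_k = A f_i + B f_j with S(x) <> 0,
    although S belongs to that ideal.  So on Z all weights but at most one, which
    is larger, are equal.

    Conversely, a relation violating the minimum condition at s [e_i] + t v_p also
    violates it for some positive integers s, t.  Transversality provides an arc
    through the point of p along which f_i vanishes to order s + t, the other
    curves of p to order t and the remaining ones to order 0; restricting the
    relation to this arc leaves one term of lowest order.  The rays reduce to
    these cones because every curve meets one of the coordinate lines. *)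

From mathcomp Require Import all_boot all_order all_algebra.
From mathcomp Require Import freeg mpoly.
From mathcomp Require Import reals lra ring zify.
From mathcomp Require boolp classical_sets.
(* Imported last, since freeg and ssrnat also define deg and eqn. *)
Require Import Defs.

Set Implicit Arguments.
Unset Strict Implicit.
Unset Printing Implicit Defensive.

Import Order.TTheory GRing.Theory Num.Theory.
Local Open Scope ring_scope.
Local Open Scope quotient_scope.

(** * The Nullstellensatz in affine 3-space *)

(** Membership is a bare [Prop], as the ideals below come from existence statements or from Zorn's
    lemma. *)
Definition ideal_pred (S : comNzRingType) (I : S -> Prop) : Prop :=
  [/\ I 0, forall a b, I a -> I b -> I (a + b) & forall a b, I b -> I (a * b)].

Definition prime_pred (S : comNzRingType) (P : S -> Prop) : Prop :=
  [/\ ideal_pred P, ~ P 1 & forall a b, P (a * b) -> P a \/ P b].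

Section Ideals.
Variable (S : comNzRingType) (P : S -> Prop).

Lemma ideal_sub a b : ideal_pred P -> P a -> P b -> P (a - b).
Proof.
by move=> [_ PD PM] Pa Pb; apply: PD => //; rewrite -mulN1r; apply: PM.
Qed.

Lemma ideal_sum (J : Type) (r : seq J) (C : pred J) (F : J -> S) :
  ideal_pred P -> (forall j, C j -> P (F j)) -> P (\sum_(j <- r | C j) F j).
Proof. by move=> [P0 PD _] PF; apply: big_ind. Qed.

Lemma primeM_out a b : prime_pred P -> ~ P a -> ~ P b -> ~ P (a * b).
Proof. by move=> [_ _ PM] Pa Pb /PM[]. Qed.

Lemma primeX_out a k : prime_pred P -> ~ P a -> ~ P (a ^+ k).
Proof.
move=> pP Pa; elim: k => [|k IH]; first by case: pP.
by rewrite exprS; apply: primeM_out.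
Qed.

End Ideals.

(** Zorn's lemma: an ideal maximal among those containing [I] and missing every power of [F] is
    prime. *)
Lemma prime_avoiding (S : comNzRingType) (I : S -> Prop) (F : S) :
    ideal_pred I -> (forall k, ~ I (F ^+ k)) ->
  exists2 P, prime_pred P & (forall a, I a -> P a) /\ ~ P F.
Proof.
move=> [I0 ID IM] IF.
(* Requiring I <= A only for nonempty A makes the union of the empty chain good. *)
pose good (A : S -> Prop) :=
  [/\ forall a b, A a -> A b -> A (a + b), forall a b, A b -> A (a * b),
      forall k, ~ A (F ^+ k) & forall a b, A a -> I b -> A b].
have [F0 Ftot|A [[AD AM AF AI] Amax]] := @classical_sets.Zorn_bigcup S good.
  move=> totF; split.
  - move=> a b [X FX Xa] [Y FY Yb].
    have [XY|YX] := totF _ _ FX FY.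
      by exists Y => //; have [+ _ _ _] := Ftot _ FY; apply=> //; apply: XY.
    by exists X => //; have [+ _ _ _] := Ftot _ FX; apply=> //; apply: YX.
  - move=> a b [X FX Xb]; exists X => //.
    by have [_ + _ _] := Ftot _ FX; apply.
  - by move=> k [X FX]; have [_ _ + _] := Ftot _ FX; apply.
  - move=> a b [X FX Xa] Ib; exists X => //.
    by have [_ _ _ +] := Ftot _ FX; apply; first exact: Xa.
(* If 0 were not in [A], then [A] would be empty and [I] itself a larger good set. *)
have A0 : A 0.
  apply: boolp.contrapT => nA0.
  have Aempty a : ~ A a by move=> Aa; apply: nA0; rewrite -(mul0r a); apply: AM.
  by apply: (Amax I); split=> //; [move=> a /Aempty | move=> /(_ 0 I0)].
exists A; last by split=> [a Ia|AF1]; [apply: AI A0 Ia | apply: (AF 1%N)].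
(* By maximality, the ideal generated by [A] and an outside element [x] contains a power of [F]. *)
have adj x : ~ A x -> exists k a, A (F ^+ k - a * x).
  move=> nAx; apply: boolp.contrapT => nF.
  apply: (Amax (fun y => exists a, A (y - a * x))).
    split=> [y Ay|/(_ x)]; first by exists 0; rewrite mul0r subr0.
    by move=> Ax; apply/nAx/Ax; exists 1; rewrite mul1r subrr.
  split=> [y z [a Ha] [b Hb]|y z [a Ha]|k [a Ha]|y z _ Iz].
  - by exists (a + b); rewrite mulrDl opprD addrACA; apply: AD.
  - by exists (y * a); rewrite -mulrA -mulrBr; apply: AM.
  - by apply: nF; exists k, a.
  - by exists 0; rewrite mul0r subr0; apply: AI A0 Iz.
split=> //; first exact: (AF 0%N).
move=> x y Axy; apply: boolp.contrapT => /boolp.not_orP[nx ny].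
have [k [a Ha]] := adj _ nx; have [l [b Hb]] := adj _ ny.
apply: (AF (k + l)%N); rewrite exprD.
rewrite -(subrK (a * x) (F ^+ k)) mulrDl; apply: (AD); first by rewrite mulrC; apply: AM.
rewrite -(subrK (b * y) (F ^+ l)) mulrDr; apply: AD; first exact: AM.
by rewrite mulrACA; apply: AM.
Qed.

Section Nullstellensatz.
Variable K : closedFieldType.

(** The Nullstellensatz as existence of a [K]-point [phi]. The avoided element lets the property
    pass from [S] to [{poly S}], where a leading coefficient has to stay nonzero. *)
Definition separates_primes (S : comNzRingType) (iota : K -> S) : Prop :=
  forall (P : S -> Prop) (F : S), prime_pred P -> ~ P F ->
  exists phi : {rmorphism S -> K},
    [/\ forall c, phi (iota c) = c, forall g, P g -> phi g = 0 & phi F != 0].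

Lemma separates_field : separates_primes (fun c : K => c).
Proof.
move=> P F [[P0 PD PM] P1 Ppr] PF; exists (idfun : {rmorphism K -> K}).
split=> //= [g Pg|]; last by apply/eqP => F0; apply: PF; rewrite F0.
apply/eqP/negPn/negP => g0; apply: P1.
by rewrite -(mulVf g0); apply: PM.
Qed.

(** If every root of [g] were a root of [F], each of the at most [size g] linear factors of [g]
    would divide [F], so [g] would divide [F ^+ size g]. *)
Lemma root_avoiding (g F : {poly K}) :
  g != 0 -> ~~ (g %| F ^+ size g) -> exists a, root g a && ~~ root F a.
Proof.
move=> g0 ngF; apply: boolp.contrapT => nex; move/negP: ngF; apply.
have rF a : root g a -> root F a.
  by move=> ga; apply/negPn/negP => Fa; apply: nex; exists a; rewrite ga Fa.
have [r gE] := closed_field_poly_normal g.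
have szr : size g = (size r).+1.
  by rewrite gE size_scale ?lead_coef_eq0 // size_prod_XsubC.
rewrite szr exprSr dvdp_mulr // gE dvdpZl ?lead_coef_eq0 //.
have : forall a, a \in r -> root F a.
  move=> a ar; apply: rF; rewrite gE rootZ ?lead_coef_eq0 //.
  by rewrite root_prod_XsubC.
elim: r {gE szr} => [|a r IH] rr; first by rewrite big_nil dvd1p.
rewrite big_cons exprS dvdp_mul //.
  by rewrite dvdp_XsubCl rr ?mem_head.
by apply: IH => b br; apply: rr; rewrite inE br orbT.
Qed.

Section PolynomialStep.
Variables (S : idomainType) (iota : K -> S).
Hypothesis sepS : separates_primes iota.
Variables (P : {poly S} -> Prop) (F : {poly S}).
Hypotheses (pP : prime_pred P) (PF : ~ P F).

Let p (r : S) : Prop := P r%:P.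

Lemma contraction_prime : prime_pred p.
Proof.
have [[P0 PD PM] P1 Ppr] := pP; split=> //; last first.
  by move=> a b; rewrite /p polyCM => /Ppr.
by split=> [|a b pa pb|a b pb]; rewrite /p ?polyCD ?polyCM; auto.
Qed.

Lemma extension_sub (h : {poly S}) : (forall j, p h`_j) -> P h.
Proof.
move=> ph; rewrite -(coefK h) poly_def; apply: ideal_sum; first by case: pP.
move=> j _; rewrite -mul_polyC mulrC.
by have [[_ _ PM] _ _] := pP; apply: (PM); apply: ph.
Qed.

(** The leading term of [h] lies in [P] because its coefficient lies in [p]; subtract it and induct
    on the size. *)
Lemma coefs_contraction k :
    (forall h, P h -> (size h < k)%N -> p (lead_coef h)) ->
  forall h, P h -> (size h < k)%N -> forall j, p h`_j.
Proof.
have [[P0 PD PM] _ _] := pP => lcp h.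
have [m] := ubnP (size h); elim: m h => // m IH h szm Ph szk j.
have [->|h0] := eqVneq h 0; first by rewrite coef0.
pose l := lead_coef h *: 'X^((size h).-1).
have Pl : P l by rewrite /l -mul_polyC mulrC; apply: (PM); apply: lcp.
have sz : (size (h - l)%R < size h)%N.
  rewrite (polySpred h0) ltnS; apply/leq_sizeP => i.
  rewrite leq_eqVlt coefB coefZ coefXn => /orP[/eqP <-|hi].
    by rewrite eqxx mulr1 subrr.
  by rewrite gtn_eqF // mulr0 subr0 nth_default // (polySpred h0).
rewrite -(subrK l h) coefD /p polyCD; apply: (PD).
  apply: IH; first by apply: leq_trans sz _.
    by apply: ideal_sub => //; case: pP.
  exact: ltn_trans sz szk.
rewrite coefZ coefXn; case: eqP => _; last by rewrite mulr0.
by rewrite mulr1; apply: lcp.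
Qed.

Lemma separates_poly_point : exists phi : {rmorphism {poly S} -> K},
  [/\ forall c, phi (iota c)%:P = c, forall g, P g -> phi g = 0 & phi F != 0].
Proof.
have [[P0 PD PM] P1 Ppr] := pP; have pp := contraction_prime.
have build (phi : {rmorphism S -> K}) (a : K) :
    (forall c, phi (iota c) = c) ->
    (forall g, P g -> (map_poly phi g).[a] = 0) -> (map_poly phi F).[a] != 0 ->
    exists phi : {rmorphism {poly S} -> K},
    [/\ forall c, phi (iota c)%:P = c, forall g, P g -> phi g = 0 & phi F != 0].
  move=> phiK Pa Fa.
  exists (horner_morph (fun r => mulrC a (phi r)) : {rmorphism _ -> _}).
  by split=> //= c; rewrite horner_morphC.
(* If no element of P has its leading coefficient outside p, then P is generated
   by p.  Otherwise, once c = lead_coef g is inverted, P is generated by p and an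
   element g of minimal degree, and a root of g is the wanted point. *)
pose bad m := exists g, [/\ P g, size g = m & ~ p (lead_coef g)].
have [[m0 bad0]|nobad] := boolp.pselect (exists m, bad m); last first.
  have Pcoef h : P h -> forall j, p h`_j.
    move=> Ph; apply: (@coefs_contraction (size h).+1) => // h' Ph' _.
    by apply: boolp.contrapT => nh'; apply: nobad; exists (size h'), h'.
  have [j nFj] : exists j, ~ p F`_j.
    by apply: boolp.contrapT => /boolp.forallNP nF; apply/PF/extension_sub => j;
       apply: boolp.contrapT.
  have [phi [phiK phip phiF]] := sepS pp nFj.
  have /closed_nonrootP[a Fa] : map_poly phi F != 0.
    by apply: contraNneq phiF => F0; rewrite -coef_map F0 coef0.
  apply: (build phi a) => // g Pg.
  rewrite (_ : map_poly phi g = 0) ?horner0 //.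
  by apply/polyP => k; rewrite coef_map coef0; apply/phip/Pcoef.
have exbad : exists m, boolp.asbool (bad m) by exists m0; apply/boolp.asboolP.
case: (ex_minnP exbad) => m /boolp.asboolP[g [Pg szg lg]] mmin {m0 bad0 exbad}.
have small h : P h -> (size h < size g)%N -> forall j, p h`_j.
  apply: coefs_contraction => h' Ph' szh'; apply: boolp.contrapT => nh'.
  have /boolp.asboolP/mmin : bad (size h') by exists h'.
  by rewrite leqNgt -szg szh'.
have g0 : g != 0 by apply/eqP => g0; apply: lg; rewrite g0 lead_coef0.
pose c := lead_coef g; pose d := size g.
pose r := (F ^+ d %% g)%R.
have divE h : (c ^+ scalp h g)%:P * h = (h %/ g) * g + h %% g.
  by rewrite mul_polyC Pdiv.WeakIdomain.divp_eq.
have Pmod h : P h -> P (h %% g).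
  move=> Ph; have -> : h %% g = (c ^+ scalp h g)%:P * h - (h %/ g) * g.
    by rewrite divE addrAC subrr add0r.
  by apply: ideal_sub; [case: pP | exact: (PM) | exact: (PM)].
have nPr : ~ P r.
  move=> Pr; have: P ((c ^+ scalp (F ^+ d) g)%:P * F ^+ d).
    by rewrite divE; apply: (PD) => //; apply: (PM).
  apply: primeM_out => //; last exact: primeX_out.
  by rewrite polyC_exp; apply: primeX_out.
have [j nrj] : exists j, ~ p r`_j.
  by apply: boolp.contrapT => /boolp.forallNP nF; apply/nPr/extension_sub => j;
     apply: boolp.contrapT.
(* One point of [S] keeps both [c] and a coefficient of [r] nonzero, so the image of [g] keeps its
   size and that of [r] is not 0. *)
have [phi [phiK phip]] := sepS pp (primeM_out pp lg nrj).
rewrite rmorphM mulf_eq0 negb_or => /andP[phic phir].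
pose f := map_poly phi.
have szfg : size (f g) = d by rewrite size_map_poly_id0.
have fg0 : f g != 0 by rewrite -size_poly_eq0 szfg size_poly_eq0.
have fdivE h : (phi c ^+ scalp h g)%:P * f h = f (h %/ g) * f g + f (h %% g).
  by have /(congr1 f) := divE h; rewrite /f rmorphM rmorphD rmorphM /= map_polyC /= rmorphXn.
have fr0 : f r != 0.
  by apply: contraNneq phir => r0; rewrite -coef_map -/f r0 coef0.
(* Otherwise the image of [g] would divide that of [F ^+ d], hence the nonzero image of [r], which
   has smaller size. *)
have [a /andP[/rootP ga Fa]] : exists a, root (f g) a && ~~ root (f F) a.
  apply: root_avoiding => //; rewrite szfg; apply/negP => gF.
  have : f g %| f r.
    have -> : f r = (phi c ^+ scalp (F ^+ d) g)%:P * f (F ^+ d) - f (F ^+ d %/ g) * f g.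
      by rewrite fdivE addrAC subrr add0r.
    apply: dvdp_sub; last exact: dvdp_mulIr.
    by apply: dvdp_mull; rewrite /f rmorphXn.
  move/dvdp_leq => /(_ fr0); rewrite leqNgt szfg => /negP; apply.
  apply: leq_ltn_trans (size_poly _ _) _; by rewrite ltn_modp.
apply: (build phi a) => // h Ph.
have /(congr1 (fun q => q.[a])) := fdivE h.
rewrite hornerD !hornerM hornerC ga mulr0 add0r.
have -> : f (h %% g) = 0.
  apply/polyP => k; rewrite coef_map coef0; apply: phip.
  by apply: small; [apply: Pmod | rewrite ltn_modp].
by rewrite horner0 => /eqP; rewrite mulf_eq0 expf_eq0 (negPf phic) andbF => /eqP.
Qed.
End PolynomialStep.

Lemma separates_poly (S : idomainType) (iota : K -> S) :
  separates_primes iota -> separates_primes (fun c => (iota c)%:P).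
Proof. by move=> sepS P F; apply: separates_poly_point. Qed.

End Nullstellensatz.

(** * Passage from iterated polynomials to polynomials in three variables *)

Lemma mpoly_ring_ind (k : nat) (A : comNzRingType) (Q : {mpoly A[k]} -> Prop) :
    (forall c, Q c%:MP) -> (forall i, Q 'X_i) ->
    (forall p q, Q p -> Q q -> Q (p + q)) ->
    (forall p q, Q p -> Q q -> Q (p * q)) -> forall p, Q p.
Proof.
move=> QC QX QD QM; elim/mpolyind => [|c m p _ _ Qp]; first by rewrite -mpolyC0.
apply: (QD) => //; rewrite -mul_mpolyC; apply: (QM) => //.
rewrite mpolyXE_id; apply: big_ind => // [|i _]; first by rewrite -mpolyC1.
elim: (m i) => [|e IH]; first by rewrite expr0 -mpolyC1.
by rewrite exprS; apply: QM.
Qed.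

Lemma mpoly_rmorph_eq (k : nat) (A B : comNzRingType)
    (f g : {rmorphism {mpoly A[k]} -> B}) :
  (forall c, f c%:MP = g c%:MP) -> (forall i, f 'X_i = g 'X_i) -> f =1 g.
Proof.
move=> fgC fgX; apply: mpoly_ring_ind => // p q fp fq.
  by rewrite !rmorphD fp fq.
by rewrite !rmorphM fp fq.
Qed.

Section AffineSpace.
Variable K : closedFieldType.

Let iter_poly := {poly {poly {poly K}}}.

Let to_iter (i : 'I_3) : iter_poly :=
  nth 0 [:: 'X%:P%:P; 'X%:P; 'X] i.

Let of_iter : iter_poly -> {mpoly K[3]} :=
  horner_morph (f := horner_morph (f := horner_morph (f := @mpolyC 3 K)
    (fun c => mulrC 'X_(inord 0) _)) (fun c => mulrC 'X_(inord 1) _))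
    (fun c => mulrC 'X_(inord 2) _).

(** A prime containing [I] and missing [F] is pulled back along [b] to the iterated polynomial ring;
    three polynomial steps over [K] give a point there, and the values of the variables are its
    coordinates. *)
Lemma nullstellensatz3 (I : {mpoly K[3]} -> Prop) (F : {mpoly K[3]}) :
    ideal_pred I -> (forall k, ~ I (F ^+ k)) ->
  exists x : 'I_3 -> K, (forall g, I g -> g.@[x] = 0) /\ F.@[x] != 0.
Proof.
move=> idI IF; have [P pP [IP nPF]] := prime_avoiding idI IF.
pose cst : {rmorphism K -> iter_poly} := polyC \o (polyC \o polyC).
pose psi : {rmorphism {mpoly K[3]} -> iter_poly} := mmap cst to_iter.
pose b : {rmorphism iter_poly -> {mpoly K[3]}} := of_iter.
have bK p : b (psi p) = p.
  apply: (mpoly_rmorph_eq (f := b \o psi) (g := idfun)) => [c|i] /=.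
    by rewrite mmapC /= /of_iter; do !rewrite horner_morphC /=.
  have -> : mmap (polyC \o (polyC \o polyC)) to_iter 'X_i = to_iter i.
    by rewrite -[RHS](mmap1U to_iter) -[RHS](mmapX to_iter cst).
  rewrite /to_iter /of_iter.
  case: i => [[|[|[|//]]] ltk] /=; do ?rewrite horner_morphC /=;
    by rewrite horner_morphX; congr 'X_(_); apply: val_inj; rewrite /= inordK.
have [] := @separates_poly K _ _ (separates_poly (separates_poly (@separates_field K)))
    (fun q => P (b q)) (psi F).
- have [[P0 PD PM] P1 Ppr] := pP; split; last 1 first.
  + by move=> q r; rewrite rmorphM => /Ppr.
  + split=> [|q r|q r]; rewrite ?rmorph0 ?rmorphD ?rmorphM //; first exact: PD.
    exact: PM.
  + by rewrite rmorph1.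
- by rewrite bK.
move=> phi [phiK phiP phiF].
pose x i := phi (psi 'X_i).
have ev p : p.@[x] = phi (psi p).
  apply: (mpoly_rmorph_eq (f := meval x) (g := phi \o psi)) => [c|i] /=.
    by rewrite mevalC mmapC /= phiK.
  by rewrite mevalXU.
exists x; split=> [g /IP Pg|]; last by rewrite ev.
by rewrite ev phiP // bK.
Qed.
End AffineSpace.

(** * Laurent polynomials and the weight filtration *)

Section Lattices.
Variables (R : realType) (n : nat) (d : 'I_n -> nat).

Lemma N_class_eqP (u v : 'rV[R]_n) :
  N_class d u = N_class d v <-> exists k, u - v = k *: \row_i (d i)%:R.
Proof.
rewrite /N_class; split => [/eqP|[k uv]].
  by rewrite -Quotient.idealrBE /degree_line => /vlineP.
by apply/eqP; rewrite -Quotient.idealrBE /degree_line uv; apply/vlineP; exists k.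
Qed.

(** Two representatives differ by a multiple of the degree vector, with which every element of
    [M_lattice d] pairs to 0. *)
Lemma pairing_class (v : 'rV[R]_n) (a : M_lattice d) :
  pairing (N_class d v) a = \sum_i (val a 0 i)%:~R * v 0 i.
Proof.
have [k uv] : exists k, repr (N_class d v) - v = k *: \row_i (d i)%:R.
  by apply/N_class_eqP; rewrite /N_class reprK.
have kd0 : \sum_i (val a 0 i)%:~R * (k * (d i)%:R) = 0 :> R.
  have /eqP/(congr1 (fun z : int => k * z%:~R)) := valP a.
  rewrite mulr0 rmorph_sum mulr_sumr => a0; rewrite -[RHS]a0.
  by apply: eq_bigr => i _; rewrite rmorphM /= mulrCA.
rewrite /pairing -[RHS]addr0 -[X in _ = _ + X]kd0.
rewrite -big_split /=; apply: eq_bigr => i _; rewrite -mulrDr; congr (_ * _).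
have /rowP/(_ i) := uv; rewrite !mxE => <-.
by rewrite [RHS]addrC subrK.
Qed.

Definition lattice_vector (a : 'rV[int]_n)
    (a0 : \sum_i a 0 i * (d i)%:Z == 0) : M_lattice d :=
  exist (fun a : 'rV[int]_n => \sum_i a 0 i * (d i)%:Z == 0) a a0.

End Lattices.

Section Evaluation.
Variables (K : fieldType) (M : choiceType).

Definition laurent_eval (t : M -> K) (g : {freeg M / K}) : K :=
  \sum_(a <- dom g) coeff a g * t a.

(** Additivity is read off from the universal map [fglift], since the sum over [dom g] has a support
    varying with [g]. *)
Lemma laurent_evalE t g : laurent_eval t g = fglift (t : M -> K^o) g.
Proof.
have fB := lift_is_additive (t : M -> K^o).
have f0 : fglift (t : M -> K^o) 0 = 0 by rewrite -[X in fglift _ X](subrr 0) fB subrr.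
have fD : {morph fglift (t : M -> K^o) : x y / x + y}.
  by move=> x y; rewrite -{1}[y]opprK fB -[- y]sub0r fB f0 sub0r opprK.
rewrite -[in RHS](freeg_sumE g) (big_morph _ fD f0).
by apply: eq_bigr => a _; rewrite liftU.
Qed.

Lemma laurent_eval0 t : laurent_eval t 0 = 0.
Proof. by rewrite /laurent_eval dom0 big_nil. Qed.

Lemma laurent_evalB t g h :
  laurent_eval t (g - h) = laurent_eval t g - laurent_eval t h.
Proof. by rewrite !laurent_evalE lift_is_additive. Qed.

Lemma laurent_evalD t g h :
  laurent_eval t (g + h) = laurent_eval t g + laurent_eval t h.
Proof.
rewrite -{1}[h]opprK laurent_evalB -[- h]sub0r laurent_evalB.
by rewrite laurent_eval0 sub0r opprK.
Qed.

Lemma laurent_evalU t c a : laurent_eval t << c *g a >> = c * t a.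
Proof. by rewrite laurent_evalE liftU. Qed.

End Evaluation.

Section Filtration.
Variables (K : fieldType) (R : realType) (n : nat) (B : arrangement K n).

Definition curve_monomial (m : 'X_{1..n}) : {mpoly K[3]} :=
  \prod_i eqn B i ^+ m i.

Definition weighted_degree (m : 'X_{1..n}) : nat := \sum_i (m i * deg B i)%N.

Lemma curve_monomialD m m' :
  curve_monomial (m + m')%MM = curve_monomial m * curve_monomial m'.
Proof. by rewrite -big_split; apply: eq_bigr => i _; rewrite mnmDE exprD. Qed.

Lemma curve_monomialU i : curve_monomial U_(i)%MM = eqn B i.
Proof.
rewrite /curve_monomial (bigD1 i) //= mnm1E eqxx expr1 big1 ?mulr1 // => j ji.
by rewrite mnm1E eq_sym (negPf ji) expr0.
Qed.

Lemma curve_monomial0 : curve_monomial 0%MM = 1.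
Proof. by rewrite /curve_monomial big1 // => i _; rewrite mnm0E expr0. Qed.

Lemma curve_monomial_homog m : curve_monomial m \is (weighted_degree m).-homog.
Proof.
rewrite /curve_monomial /weighted_degree.
elim/big_rec2: _ => [|i p e _ hp]; first exact: dhomog1.
by rewrite mulnC; apply: dhomogM => //; apply/dhomogMn/eqn_homog.
Qed.

Variable v : 'rV[R]_n.

Definition weight (m : 'X_{1..n}) : R := \sum_i (m i)%:R * v 0 i.

Lemma weightD m m' : weight (m + m')%MM = weight m + weight m'.
Proof.
by rewrite -big_split; apply: eq_bigr => i _; rewrite mnmDE natrD mulrDl.
Qed.

Lemma weightU i : weight U_(i)%MM = v 0 i.
Proof.
rewrite /weight (bigD1 i) //= mnm1E eqxx mul1r big1 ?addr0 // => j ji.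
by rewrite mnm1E eq_sym (negPf ji) mul0r.
Qed.

Lemma weight0 : weight 0%MM = 0.
Proof. by rewrite /weight big1 // => i _; rewrite mnm0E mul0r. Qed.

(** The span over [K] of the curve monomials of weight at least [theta]. A polynomial may have many
    such expressions, of mixed degrees; the derivation carries one of them. *)
Inductive filtered (theta : R) : {mpoly K[3]} -> Prop :=
| filtered0 : filtered theta 0
| filtered_cons c m h : theta <= weight m -> filtered theta h ->
    filtered theta (c *: curve_monomial m + h).

Lemma filtered_monomial theta m :
  theta <= weight m -> filtered theta (curve_monomial m).
Proof.
move=> le; rewrite -[X in filtered _ X]scale1r -[X in filtered _ X]addr0.
by apply: filtered_cons => //; apply: filtered0.
Qed.

Lemma filteredW theta theta' h : theta' <= theta -> filtered theta h -> filtered theta' h.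
Proof.
move=> le; elim=> [|c m {}h lem _ IH]; first exact: filtered0.
by apply: filtered_cons => //; apply: le_trans lem.
Qed.

Lemma filteredD theta g h : filtered theta g -> filtered theta h -> filtered theta (g + h).
Proof.
move=> Fg Fh; elim: Fg => [|c m g' lem _ IH]; first by rewrite add0r.
by rewrite -addrA; apply: filtered_cons.
Qed.

Lemma filteredM theta theta' g h :
  filtered theta g -> filtered theta' h -> filtered (theta + theta') (g * h).
Proof.
move=> + Fh; elim=> [|c m g1 lem _ IH]; first by rewrite mul0r; apply: filtered0.
rewrite mulrDl; apply: filteredD; last exact: IH.
elim: Fh {IH} => [|c' m' h1 lem' _ IH']; first by rewrite mulr0; apply: filtered0.
rewrite mulrDr -scalerAl -scalerAr scalerA -curve_monomialD.
by apply: filtered_cons => //; rewrite weightD lerD.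
Qed.

Lemma eval_monomial_ratio x (m m0 : 'X_{1..n}) (a : M_lattice (deg B)) :
    in_complement B x -> (forall i, val a 0 i = (m i)%:Z - (m0 i)%:Z) ->
  intrinsic_embedding B x a * (curve_monomial m0).@[hcoord x] =
  (curve_monomial m).@[hcoord x].
Proof.
move=> xB aE; rewrite /curve_monomial !rmorph_prod -big_split /=.
apply: eq_bigr => i _; have nz : (eqn B i).@[hcoord x] != 0 := xB i.
by rewrite !rmorphXn /= aE expfzDr // -exprnN -exprnP mulfVK // expf_eq0 (negPf nz) andbF.
Qed.

(** Dividing by the monomial of [m0] turns each monomial of the same weighted degree into a
    character, its weight lowered by [weight m0]. Monomials of other degrees give no character;
    [pihomog] removes them. *)
Lemma filtered_laurent theta (m0 : 'X_{1..n}) h : filtered theta h ->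
  exists g : {freeg (M_lattice (deg B)) / K},
    (forall a, a \in dom g -> theta - weight m0 <= pairing (N_class (deg B) v) a) /\
    forall x, in_complement B x ->
      laurent_eval (intrinsic_embedding B x) g * (curve_monomial m0).@[hcoord x] =
      (pihomog [measure of mdeg] (weighted_degree m0) h).@[hcoord x].
Proof.
elim=> [|c m h' lem _ [g [gw gE]]].
  exists 0; split=> [a|x _]; first by rewrite dom0.
  by rewrite laurent_eval0 mul0r pihomog0 meval0.
have [dm|dm] := eqVneq (weighted_degree m) (weighted_degree m0); last first.
  exists g; split=> // x xB.
  by rewrite gE // linearP /= (pihomog_ne0 dm (curve_monomial_homog m)) scaler0 add0r.
have aP : \sum_i (\row_i ((m i)%:Z - (m0 i)%:Z)) 0 i * (deg B i)%:Z == 0.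
  apply/eqP; have /(congr1 (fun k : nat => k%:Z)) := dm.
  rewrite /weighted_degree !(big_morph Posz PoszD (erefl _)) => /eqP.
  rewrite -subr_eq0 -sumrB => /eqP d0; rewrite -[RHS]d0; apply: eq_bigr => i _.
  by rewrite mxE mulrBl !PoszM.
pose a : M_lattice (deg B) := lattice_vector aP.
have aE i : val a 0 i = (m i)%:Z - (m0 i)%:Z by rewrite mxE.
exists (<< c *g a >> + g); split=> [b /domD_subset|x xB].
  rewrite mem_cat => /orP[|/gw //].
  have [->|c0] := eqVneq c 0; first by rewrite freegU0 dom0.
  rewrite domU // inE => /eqP ->; rewrite pairing_class lerBlDr.
  rewrite (_ : _ + _ = weight m) // -big_split; apply: eq_bigr => i _ /=.
  by rewrite aE rmorphB /= mulrBl subrK.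
rewrite laurent_evalD mulrDl gE // laurent_evalU -mulrA.
rewrite (eval_monomial_ratio xB aE) linearP /= mevalD mevalZ.
by rewrite -dm [pihomog _ _ (curve_monomial m)]pihomog_dE ?curve_monomial_homog.
Qed.

(** If [theta] exceeded [weight m0], division by the monomial of [m0] would give a relation [g - 1]
    on the complement whose constant term alone has the minimal weight 0. *)
Lemma trop_weight_le theta m0 :
    trop_complement B (N_class (deg B) v) ->
  filtered theta (curve_monomial m0) -> theta <= weight m0.
Proof.
move=> tropv /(filtered_laurent m0)[g [gw gE]].
rewrite leNgt; apply/negP => lt0.
have o0 : \sum_i (0 : 'rV[int]_n) 0 i * (deg B i)%:Z == 0.
  by apply/eqP/big1 => i _; rewrite mxE mul0r.
pose o : M_lattice (deg B) := lattice_vector o0.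
have po : pairing (N_class (deg B) v) o = 0.
  by rewrite pairing_class big1 // => i _; rewrite mxE mul0r.
have og : o \notin dom g.
  by apply/negP => /gw; rewrite po subr_le0 leNgt lt0.
pose g' := g - << 1 *g o >>.
have og' : o \in dom g'.
  by rewrite mem_dom coeffB coeffU eqxx mulr1 coeff_outdom // sub0r oppr_eq0 oner_eq0.
have gw' a : a \in dom g' -> a != o -> 0 < pairing (N_class (deg B) v) a.
  move=> /domB; rewrite mem_cat => /orP[/gw|]; last by rewrite domU1 inE => ->.
  by move=> ge _; apply: lt_le_trans ge; rewrite subr_gt0.
have /tropv[g'0|[a [b [ag bg ab]]]] : vanishes_on (embedded_complement B) g'.
  move=> t [x xB ->]; rewrite -/(laurent_eval _ _) laurent_evalB laurent_evalU mul1r.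
  have nz : (curve_monomial m0).@[hcoord x] != 0.
    rewrite rmorph_prod; apply/prodf_neq0 => i _.
    by rewrite rmorphXn expf_neq0 //; apply: xB.
  have io : intrinsic_embedding B x o = 1.
    by apply: big1 => i _; rewrite mxE expr0z.
  apply/eqP; rewrite subr_eq0 io -(inj_eq (mulIf nz)) gE // mul1r pihomog_dE //.
  exact: curve_monomial_homog.
- by move: og'; rewrite g'0 dom0.
rewrite /trivial_valuation !add0r => pab /(_ o og'); rewrite add0r po => a0.
have ao : a = o by apply/eqP/negPn/negP => /(gw' _ ag); rewrite ltNge a0.
have bo : b = o.
  by apply/eqP/negPn/negP => /(gw' _ bg); rewrite -pab ltNge a0.
by rewrite ao bo eqxx in ab.
Qed.

End Filtration.

(** * Transverse intersections and arcs *)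

Lemma hcoord_neq0 (K : fieldType) (x : proj_plane K) : exists r, hcoord x r != 0.
Proof.
have : vpick (val x) != 0.
  by rewrite vpick0 -dimv_eq0; have /eqP -> := valP x.
move=> x0; apply: boolp.contrapT => /boolp.forallNP nx; move/eqP: x0; apply.
by apply/rowP => k; rewrite mxE; apply/eqP/negPn/negP/nx.
Qed.

Lemma add_fractions (L : fieldType) (a b f g s t h l : L) :
    s != 0 -> t != 0 -> h != 0 -> l != 0 ->
  (a / s * (f / h) + b / t * (g / l)) * (s * h * (t * l)) =
  a * (t * l) * f + b * (s * h) * g.
Proof. by move=> s0 t0 h0 l0; field; rewrite s0 t0 h0 l0. Qed.

Lemma sub_fractions (L : fieldType) (c a s a' s' S : L) :
    s != 0 -> s' != 0 ->
  S * (s * a' - c * a * s') = s * s' * ((a' / s' - c * (a / s)) * S).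
Proof. by move=> s0 s0'; field; rewrite s0 s0'. Qed.

Section LocalIntersection.
Variables (K : fieldType) (x : proj_plane K) (f g : {mpoly K[3]}).
Hypotheses (fx : f.@[hcoord x] = 0) (gx : g.@[hcoord x] = 0).

Lemma local_ideal_fraction u : local_ideal x f g u ->
  exists S A B : {mpoly K[3]},
    (S.@[hcoord x] != 0 /\ exists d, S \is d.-homog) /\
    u * tofrac S = tofrac (A * f + B * g).
Proof.
case=> _ [_ [_ [_ [[e1 [a [s [_ hs s0 ->]]]] [e2 [b [t [_ ht t0 ->]]]]
  [e3 [h [_ hh h0 ->]]] [e4 [l [_ hl l0 ->]]] ->]]]].
exists (s * h * (t * l)), (a * (t * l)), (b * (s * h)).
split.
  split; first by rewrite !rmorphM !mulf_neq0.
  by exists (e1 + e3 + (e2 + e4))%N; do ![apply: dhomogM].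
have nz (p : {mpoly K[3]}) : p.@[hcoord x] != 0 -> tofrac p != 0.
  by rewrite tofrac_eq0; apply: contraNneq => ->; rewrite meval0.
rewrite !(rmorphM, rmorphD) /=.
by apply: add_fractions; apply: nz.
Qed.

(** Multiplicity 1 makes the quotient of the local ring one-dimensional, so the local equations
    generate the maximal ideal, which contains every local function vanishing at [x]; [S] clears
    denominators. *)
Lemma vanishing_in_ideal e (h : {mpoly K[3]}) :
    intersection_multiplicity x f g 1 -> h \is e.-homog -> h.@[hcoord x] = 0 ->
  exists S A B : {mpoly K[3]},
    (S.@[hcoord x] != 0 /\ exists d, S \is d.-homog) /\ S * h = A * f + B * g.
Proof.
case=> b [bL bB] hh hx.
have [d [a [s [_ _ s0 bE]]]] := bL ord0.
have [r xr] := hcoord_neq0 x.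
have nz (p : {mpoly K[3]}) : p.@[hcoord x] != 0 -> tofrac p != 0.
  by rewrite tofrac_eq0; apply: contraNneq => ->; rewrite meval0.
(* A power of a coordinate nonzero at [x] makes [h / q] an element of the local ring. *)
pose q : {mpoly K[3]} := 'X_r ^+ e.
have q0 : q.@[hcoord x] != 0 by rewrite rmorphXn /= mevalXU expf_neq0.
have frac e' (a' s' : {mpoly K[3]}) : a' \is e'.-homog -> s' \is e'.-homog ->
    s'.@[hcoord x] != 0 -> exists c : K, exists S A B : {mpoly K[3]},
    (S.@[hcoord x] != 0 /\ exists d, S \is d.-homog) /\
    S * (s * a' - c *: a * s') = s * s' * (A * f + B * g).
  move=> ha hs ss0.
  have [|c [/local_ideal_fraction[S [A [B' [S0 cE]]]] _]] := bB (tofrac a' / tofrac s').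
    by exists e', a', s'.
  exists (c ord0), S, A, B'; split=> //; move: cE.
  rewrite big_ord1 bE -mul_mpolyC => cE; apply/eqP.
  rewrite -tofrac_eq [X in _ == X]rmorphM /= -cE !(rmorphM, rmorphB) /=.
  by apply/eqP; apply: sub_fractions; apply: nz.
(* Applied to the constant 1 and evaluated at [x]: the basis element [a / s] does not vanish at
   [x]. *)
have [|c1 [S1 [A1 [B1 [[S10 _] /(congr1 (meval (hcoord x)))]]]]] :=
  frac 0%N 1 1 (dhomog1 _ _) (dhomog1 _ _).
  by rewrite meval1 oner_eq0.
rewrite !(mevalM, mevalB, mevalD, mevalZ, meval1) fx gx !mulr0 addr0 mulr0 !mulr1 => /eqP.
rewrite mulf_eq0 (negPf S10) /= subr_eq0 => /eqP sca.
have ax : a.@[hcoord x] != 0 by apply: contraNneq s0 => a0; rewrite sca a0 mulr0.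
have hq : q \is e.-homog.
  by rewrite -[e]mul1n; apply: dhomogMn; rewrite dhomogX /= mdeg1.
(* Applied to [h / q] and evaluated at [x]: the coefficient [c] is 0, so [h / q] itself lies in the
   local ideal. *)
have [c [S [A [B [[S0 hS] E]]]]] := frac e h q hh hq q0.
have /(congr1 (meval (hcoord x))) := E.
rewrite !(mevalM, mevalB, mevalD, mevalZ) fx gx hx !mulr0 addr0 mulr0 sub0r => /eqP.
rewrite mulf_eq0 (negPf S0) oppr_eq0 !mulf_eq0 (negPf ax) (negPf q0) !orbF /= => /eqP c0.
move: E; rewrite c0 scale0r mul0r subr0 => E.
exists S, (q * A), (q * B); split=> //.
have s00 : s != 0 by apply: contraNneq s0 => ->; rewrite meval0.
apply: (mulfI s00); rewrite -!mulrA -mulrDr.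
by rewrite mulrCA E mulrA.
Qed.
End LocalIntersection.

(** * Directional derivatives and tangent vectors *)

Definition directional (K : fieldType) (f : {mpoly K[3]}) (x v : 'I_3 -> K) : K :=
  \sum_k f^`M(k).@[x] * v k.

Section Directional.
Variable K : fieldType.
Implicit Types (f g : {mpoly K[3]}) (x v : 'I_3 -> K).

Lemma directionalD f g x v :
  directional (f + g) x v = directional f x v + directional g x v.
Proof.
by rewrite -big_split; apply: eq_bigr => k _; rewrite mderivD mevalD mulrDl.
Qed.

Lemma directionalM f g x v :
  directional (f * g) x v = directional f x v * g.@[x] + f.@[x] * directional g x v.
Proof.
rewrite mulr_suml mulr_sumr -big_split; apply: eq_bigr => k _ /=.
by rewrite mderivM mevalD !mevalM; ring.
Qed.

Definition linear_form (c : 'I_3 -> K) : {mpoly K[3]} := \sum_k c k *: 'X_k.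

Lemma linear_form_homog c : linear_form c \is 1.-homog.
Proof. by apply: rpred_sum => k _; apply/rpredZ; rewrite dhomogX /= mdeg1. Qed.

Lemma linear_form_eval c x : (linear_form c).@[x] = \sum_k c k * x k.
Proof. by rewrite rmorph_sum; apply: eq_bigr => k _; rewrite /= mevalZ mevalXU. Qed.

Lemma directional_linear_form c x v :
  directional (linear_form c) x v = \sum_k c k * v k.
Proof.
apply: eq_bigr => k _; congr (_ * _).
rewrite /linear_form (raddf_sum (mderiv k)) (raddf_sum (meval x)) (bigD1 k) //=.
rewrite big1 => [|l lk]; last first.
  by rewrite mderivZ mderivX mnm1E (negPf lk) scale0r scaler0 meval0.
rewrite mderivZ mderivX mnm1E eqxx scale1r addr0 mevalZ.
by rewrite -[X in 'X_[X - _]]addm0 addmC addmK mpolyX0 meval1 mulr1.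
Qed.

(** The kernel of [q] has dimension at least 2, so it contains a [v] outside the span of [x]; a
    column of the cokernel of [x] gives a form [c] telling them apart. *)
Lemma exists_transverse_vector (q x : 'I_3 -> K) :
  exists v c, [/\ \sum_k q k * v k = 0, \sum_k c k * x k = 0
                & \sum_k c k * v k != 0].
Proof.
pose Q : 'cV[K]_3 := \col_k q k; pose X : 'rV[K]_3 := \row_k x k.
have : ~~ (kermx Q <= X)%MS.
  apply/negP => /mxrankS; rewrite mxrank_ker leqNgt => /negP; apply.
  by have := rank_leq_row X; have := rank_leq_col Q; lia.
case/row_subPn => r; set v := row r _; rewrite submxE => vX.
have [k] : exists k, (v *m cokermx X) 0 k != 0.
  apply: boolp.contrapT => /boolp.forallNP nv; move/eqP: vX; apply.
  by apply/rowP => k; rewrite [RHS]mxE; apply/eqP/negPn/negP/nv.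
rewrite mxE => vk; exists (v 0), (fun l => cokermx X l k); split.
- have : v *m Q = 0 by apply/sub_kermxP; apply: row_sub.
  move/matrixP/(_ 0 0); rewrite !mxE => vQ; rewrite -[RHS]vQ.
  by apply: eq_bigr => l _; rewrite [Q _ _]mxE mulrC.
- have := mulmx_coker X; move/matrixP/(_ 0 k); rewrite !mxE => XQ; rewrite -[RHS]XQ.
  by apply: eq_bigr => l _; rewrite [X _ _]mxE mulrC.
- by rewrite (eq_bigr (fun l => v 0 l * cokermx X l k)) // => l _; rewrite mulrC.
Qed.

(** The linear form [c] vanishes at [x], so a multiple [S c] is [A f + B g]. Differentiating along
    [v] gives [S(x) c(v)] on the left, which is nonzero, so [f] and [g] cannot both have derivative
    0. *)
Lemma transverse_directional (x : proj_plane K) f g v c :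
    f.@[hcoord x] = 0 -> g.@[hcoord x] = 0 -> intersection_multiplicity x f g 1 ->
    \sum_k c k * hcoord x k = 0 -> \sum_k c k * v k != 0 ->
  directional f (hcoord x) v = 0 -> directional g (hcoord x) v != 0.
Proof.
move=> fx gx mult cx cv fv; apply/eqP => gv.
have [|S [A [B [[S0 _]]]]] := vanishing_in_ideal fx gx mult (linear_form_homog c).
  by rewrite linear_form_eval.
move/(congr1 (fun h => directional h (hcoord x) v)).
rewrite directionalD !directionalM fx gx fv gv linear_form_eval cx.
rewrite directional_linear_form !mulr0 !addr0 add0r => /eqP.
by rewrite mulf_eq0 (negPf S0) (negPf cv).
Qed.

End Directional.

(** A vector [v] tangent to the curve [i] and not proportional to the point is transverse to the
    other curves. If all derivatives of the equation of [i] vanished, a vector tangent to [j0] would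
    be tangent to both curves. *)
Lemma tangent_frame (K : fieldType) (n : nat) (B : arrangement K n) x (i j0 : 'I_n) :
    transverse B -> i \in curves_through B x -> j0 \in curves_through B x ->
    j0 != i ->
  exists v u, [/\ directional (eqn B i) (hcoord x) v = 0,
    directional (eqn B i) (hcoord x) u != 0
    & forall j, j \in curves_through B x -> j != i ->
        directional (eqn B j) (hcoord x) v != 0].
Proof.
move=> tr; rewrite inE => xi xj0 j0i.
have tv v c : \sum_k c k * hcoord x k = 0 -> \sum_k c k * v k != 0 ->
    directional (eqn B i) (hcoord x) v = 0 ->
    forall j, j \in curves_through B x -> j != i ->
    directional (eqn B j) (hcoord x) v != 0.
  move=> cx cv iv j; rewrite inE => xj ji.
  by apply: (transverse_directional _ _ _ cx cv iv); [exact/eqP | exact/eqP |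
    apply: tr => //; rewrite eq_sym].
have [v [c [iv cx cv]]] :=
  exists_transverse_vector (fun k => (eqn B i)^`M(k).@[hcoord x]) (hcoord x).
have [u iu] : exists u, directional (eqn B i) (hcoord x) u != 0.
  apply: boolp.contrapT => /boolp.forallNP nu.
  have {}nu u : directional (eqn B i) (hcoord x) u = 0 by apply/eqP/negPn/negP/nu.
  have [v' [c' [jv cx' cv']]] :=
    exists_transverse_vector (fun k => (eqn B j0)^`M(k).@[hcoord x]) (hcoord x).
  have := tv v' c' cx' cv' (nu v') j0 xj0 j0i.
  by rewrite /directional jv eqxx.
by exists v, u; split=> //; apply: tv cx cv iv.
Qed.

(** * Polynomial arcs with prescribed contact orders *)

Section Arcs.
Variable K : fieldType.
Implicit Types (f : {mpoly K[3]}) (x v u : 'I_3 -> K) (gamma : 'I_3 -> {poly K}).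

Definition along gamma f : {poly K} := mmap (@polyC K) gamma f.

Lemma alongM gamma : {morph along gamma : f g / f * g}.
Proof. by move=> f g; rewrite /along rmorphM. Qed.

Lemma alongD gamma : {morph along gamma : f g / f + g}.
Proof. by move=> f g; rewrite /along mmapD. Qed.

Lemma along_horner gamma f a : (along gamma f).[a] = f.@[fun k => (gamma k).[a]].
Proof.
elim/mpoly_ring_ind: f => [c|i|p q IHp IHq|p q IHp IHq].
- by rewrite /along mmapC hornerC mevalC.
- by rewrite /along mmapX mmap1U mevalXU.
- by rewrite alongD hornerD IHp IHq mevalD.
- by rewrite alongM hornerM IHp IHq mevalM.
Qed.

Lemma along_const x f : along (fun k => (x k)%:P) f = (f.@[x])%:P.
Proof.
elim/mpoly_ring_ind: f => [c|i|p q IHp IHq|p q IHp IHq].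
- by rewrite /along mmapC mevalC.
- by rewrite /along mmapX mmap1U mevalXU.
- by rewrite alongD IHp IHq mevalD polyCD.
- by rewrite alongM IHp IHq mevalM polyCM.
Qed.

(** Induction on the ring structure of [f] involves no division, so the expansion holds in every
    characteristic. *)
Lemma along_taylor gamma (delta : 'I_3 -> {poly K}) (e : {poly K}) f :
  exists r : {poly K},
  along (fun k => gamma k + e * delta k) f =
  along gamma f + e * (\sum_k along gamma f^`M(k) * delta k) + e ^+ 2 * r.
Proof.
pose gd k := gamma k + e * delta k; rewrite -/gd.
elim/mpoly_ring_ind: f => [c|i|p q [r pE] [s qE]|p q [r pE] [s qE]].
- exists 0; rewrite /along !mmapC mulr0 addr0 big1 ?mulr0 ?addr0 // => k _.
  by rewrite mderivC mmap0 mul0r.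
- exists 0; rewrite mulr0 addr0 /along !mmapX !mmap1U; congr (_ + e * _).
  rewrite (bigD1 i) //= mderivX mnm1E eqxx scale1r big1 => [|k ki]; last first.
    by rewrite mderivX mnm1E eq_sym (negPf ki) scale0r mmap0 mul0r.
  by rewrite -[X in 'X_[X - _]]addm0 addmC addmK mpolyX0 rmorph1 mul1r addr0.
- exists (r + s); rewrite !alongD pE qE.
  have -> : \sum_k along gamma (p + q)^`M(k) * delta k =
      \sum_k along gamma p^`M(k) * delta k + \sum_k along gamma q^`M(k) * delta k.
    by rewrite -big_split; apply: eq_bigr => k _ /=; rewrite mderivD alongD mulrDl.
  by ring.
- pose P := \sum_k along gamma p^`M(k) * delta k.
  pose Q := \sum_k along gamma q^`M(k) * delta k.
  exists (r * along gd q + along gamma p * s + P * Q + e * P * s).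
  have -> : \sum_k along gamma (p * q)^`M(k) * delta k =
      P * along gamma q + along gamma p * Q.
    rewrite /P /Q mulr_suml mulr_sumr -big_split; apply: eq_bigr => k _ /=.
    by rewrite mderivM alongD !alongM; ring.
  by rewrite !alongM pE qE -/P -/Q; ring.
Qed.

(** The arc leaves [x] in direction [v] at order [t]; the parameter [h] bends it towards [u] in
    order to tune its contact with one curve. *)
Definition arc x v u t (h : {poly K}) (k : 'I_3) : {poly K} :=
  (x k)%:P + 'X^t * ((v k)%:P + 'X * h * (u k)%:P).

Lemma arc0 x v u t h k : (0 < t)%N -> (arc x v u t h k).[0] = x k.
Proof.
move=> t0; rewrite /arc hornerD hornerM hornerXn hornerC expr0n.
by rewrite gtn_eqF // mul0r addr0.
Qed.

Lemma along_arc x v u t h f : exists r : {poly K},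
  along (arc x v u t h) f = (f.@[x])%:P +
    'X^t * (\sum_k (f^`M(k).@[x])%:P * ((v k)%:P + 'X * h * (u k)%:P)) +
    'X^t ^+ 2 * r.
Proof.
have [r E] := along_taylor (fun k => (x k)%:P)
  (fun k => (v k)%:P + 'X * h * (u k)%:P) 'X^t f.
exists r; rewrite /arc E along_const; congr (_ + _ * _ + _).
by apply: eq_bigr => k _; rewrite along_const.
Qed.

Lemma along_arc_transverse x v u t h f : (0 < t)%N -> f.@[x] = 0 ->
    directional f x v != 0 ->
  exists q : {poly K}, along (arc x v u t h) f = 'X^t * q /\ q.[0] != 0.
Proof.
move=> t0 fx fv; have [r ->] := along_arc x v u t h f.
exists (\sum_k (f^`M(k).@[x])%:P * ((v k)%:P + 'X * h * (u k)%:P) + 'X^t * r).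
split; first by rewrite fx polyC0; ring.
rewrite hornerD hornerM hornerXn expr0n gtn_eqF // mul0r addr0 horner_sum.
rewrite (eq_bigr (fun k => f^`M(k).@[x] * v k)) // => k _.
by rewrite hornerM hornerD !hornerM hornerX !hornerC !mul0r addr0.
Qed.

(** A Hensel step: adding [c X^b] to [h] moves the arc by [c X^(t+1+b) u], which changes the
    coefficient of that order by [c] times the derivative along [u]. *)
Lemma along_arc_adjust x v u t b h f q z : (0 < t)%N ->
    directional f x u != 0 -> along (arc x v u t h) f = 'X^(t.+1 + b) * q ->
  exists h' q' : {poly K},
    along (arc x v u t h') f = 'X^(t.+1 + b) * q' /\ q'.[0] = z.
Proof.
move=> t0 fu E; pose c := (z - q.[0]) / directional f x u.
have [r E'] := along_taylor (arc x v u t h) (fun k => (c * u k)%:P) 'X^(t.+1 + b) f.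
exists (h + c%:P * 'X^b).
exists (q + \sum_k along (arc x v u t h) f^`M(k) * (c * u k)%:P + 'X^(t.+1 + b) * r).
split.
  transitivity (along (fun k => arc x v u t h k + 'X^(t.+1 + b) * (c * u k)%:P) f).
    congr along; apply: boolp.funext => k.
    by rewrite /arc exprD exprS polyCM; ring.
  by rewrite E' E; ring.
rewrite !hornerD hornerM hornerXn expr0n /= mul0r addr0 horner_sum.
rewrite (eq_bigr (fun k => c * (f^`M(k).@[x] * u k))) => [|k _].
  by rewrite -mulr_sumr mulfVK // addrC subrK.
rewrite hornerM along_horner hornerC mulrCA; congr (_ * (_ * _)).
by apply: meval_eq => l; apply: arc0.
Qed.

(** Adjusting the lowest coefficient to 0 raises the order by one; a last adjustment to 1 makes the
    order exact. *)
Lemma exists_tangent_arc x v u t b f : (0 < t)%N -> f.@[x] = 0 ->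
    directional f x v = 0 -> directional f x u != 0 ->
  exists h q : {poly K}, along (arc x v u t h) f = 'X^(t.+1 + b) * q /\ q.[0] != 0.
Proof.
move=> t0 fx fv fu.
suff [h [q hq]] : exists h q : {poly K}, along (arc x v u t h) f = 'X^(t.+1 + b) * q.
  have [h' [q' [E q1]]] := along_arc_adjust (1 : K) t0 fu hq.
  by exists h', q'; rewrite E q1 oner_eq0.
elim: b => [|b [h [q E]]].
  (* With [h = 0] the linear term vanishes because [v] is tangent, and the rest has order [2 * t],
     at least [t.+1]. *)
  have [r E] := along_arc x v u t 0 f; exists 0, ('X^(t.-1) * r).
  rewrite E fx polyC0 add0r [X in 'X^t * X](_ : _ = 0) ?mulr0 ?add0r.
    by rewrite addn0 mulrA -exprD -exprM; congr ('X^_ * r); lia.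
  rewrite (eq_bigr (fun k => (f^`M(k).@[x] * v k)%:P)) => [|k _].
    by rewrite -rmorph_sum /= -/(directional f x v) fv.
  by rewrite mul0r addr0 polyCM.
have [h' [q' [E' q0]]] := along_arc_adjust (0 : K) t0 fu E.
have [q1 q1E] : exists q1, q' = 'X * q1.
  have /factor_theorem[q1 q1E] : root q' 0 by apply/rootP.
  by exists q1; rewrite q1E polyC0 subr0 mulrC.
by exists h', q1; rewrite E' q1E addnS exprSr mulrA.
Qed.
End Arcs.

(** * Coordinate lines *)

Section Homogeneous.
Variable K : fieldType.
Implicit Types (f : {mpoly K[3]}) (x y : 'I_3 -> K).

Lemma meval_homog_scale d f x y (c : K) : f \is d.-homog ->
  (forall k, x k = c * y k) -> f.@[x] = c ^+ d * f.@[y].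
Proof.
move=> /dhomogP hf xy; rewrite !mevalE mulr_sumr; apply: eq_big_seq => m mf.
rewrite mulrCA; congr (_ * _); rewrite -(hf m mf) /= mdegE -prodrXr -big_split /=.
by apply: eq_bigr => i _; rewrite xy exprMn.
Qed.

Lemma homog1_linear_form f : f \is 1.-homog -> f = linear_form (fun k => f@_U_(k)).
Proof.
move=> hf; apply/mpolyP => m; rewrite /linear_form raddf_sum /=.
have [/existsP[i /eqP ->]|] := boolP [exists i : 'I_3, m == U_(i)%MM].
  rewrite (bigD1 i) //= mcoeffZ mcoeffX eqxx mulr1 big1 ?addr0 // => j ji.
  rewrite mcoeffZ mcoeffX; case: eqP => [/mnmP/(_ j)|_]; last by rewrite mulr0.
  by rewrite !mnm1E eqxx eq_sym (negPf ji).
rewrite -mdeg_eq1 => m1; rewrite (dhomog_nemf_coeff hf m1) big1 // => j _.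
rewrite mcoeffZ mcoeffX; case: eqP => [E|_]; last by rewrite mulr0.
by rewrite -E mdeg1 eqxx in m1.
Qed.

Lemma exists_proj_point y r : y r != 0 ->
  exists (x : proj_plane K) (c : K), c != 0 /\ forall k, hcoord x k = c * y k.
Proof.
move=> yr; pose Y : 'rV[K]_3 := \row_k y k.
have Y0 : Y != 0 by apply: contraNneq yr => /rowP/(_ r); rewrite !mxE => ->.
have dY : \dim <[Y]> == 1%N by rewrite dim_vline Y0.
exists (exist (fun L => \dim L == 1%N) <[Y]>%VS dY).
have /vlineP[c cE] := memv_pick <[Y]>%VS.
exists c; split=> [|k].
  apply: contraNneq Y0 => c0; move: cE; rewrite c0 scale0r => /eqP.
  by rewrite vpick0 -dimv_eq0 dim_vline; case: (Y == 0).
by rewrite /hcoord /= cE !mxE.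
Qed.

End Homogeneous.

Section Lines.
Variables (K : fieldType) (n : nat) (B : arrangement K n).

Lemma deg_gt0 i : (0 < deg B i)%N.
Proof.
have [f0 nu _] := eqn_irreducible B i; rewrite lt0n; apply: contra nu => /eqP d0.
have := eqn_homog B i; rewrite d0 => hf.
have fE : eqn B i = ((eqn B i)@_0)%:MP.
  apply/mpolyP => m; rewrite mcoeffC; have [<-|m0] := eqVneq 0%MM m; first by rewrite mulr1.
  by rewrite mulr0 (dhomog_nemf_coeff hf) //= mdeg_eq0 eq_sym.
rewrite fE; apply: (rmorph_unit (@mpolyC 3 K)); rewrite unitfE.
by apply: contraNneq f0 => c0; rewrite fE c0.
Qed.

Lemma eqn_at0 i y : (forall k, y k = 0) -> (eqn B i).@[y] = 0.
Proof.
move=> y0; rewrite (meval_homog_scale (c := 0) (y := y) (eqn_homog B i)).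
  by rewrite expr0n gtn_eqF ?deg_gt0 // mul0r.
by move=> k; rewrite y0 mul0r.
Qed.

Lemma eqn_neq0_point i y : (eqn B i).@[y] != 0 ->
  exists (x : proj_plane K) (c : K), c != 0 /\ forall k, hcoord x k = c * y k.
Proof.
move=> iy; have [r yr] : exists r, y r != 0; last exact: exists_proj_point yr.
apply: boolp.contrapT => /boolp.forallNP ny; move/eqP: iy; apply.
by apply: eqn_at0 => k; apply/eqP/negPn/negP/ny.
Qed.

Lemma on_curve_scale i (x : proj_plane K) y c : c != 0 ->
  (forall k, hcoord x k = c * y k) -> on_curve (eqn B i) x = ((eqn B i).@[y] == 0).
Proof.
move=> c0 xy; rewrite /on_curve (meval_homog_scale (eqn_homog B i) xy).
by rewrite mulf_eq0 expf_eq0 (negPf c0) andbF.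
Qed.

(** The coefficient matrix of the three lines is invertible, since a kernel vector would be a common
    point. The rows of its inverse [P] are the vertices of the triangle. *)
Lemma coordinate_lines : very_affine B ->
  exists (L : 'I_3 -> 'I_n) (P : 'I_3 -> 'I_3 -> K),
  [/\ injective L, forall a, deg B (L a) = 1%N,
      forall k, 'X_k = \sum_a P a k *: eqn B (L a)
    & forall b a, (eqn B (L a)).@[P b] = (b == a)%:R].
Proof.
case=> i [j [k [uL di dj dk noc]]].
pose L (a : 'I_3) := nth i [:: i; j; k] a.
have dL a : deg B (L a) = 1%N by case: a => [[|[|[|//]]] lta].
pose M : 'M[K]_3 := \matrix_(b, a) (eqn B (L a))@_U_(b).
have LE a : eqn B (L a) = linear_form (fun b => M b a).
  rewrite {1}[eqn B (L a)]homog1_linear_form; last by have := eqn_homog B (L a); rewrite dL.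
  by apply: eq_bigr => b _; rewrite mxE.
have ev a (y : 'rV[K]_3) : (eqn B (L a)).@[y 0] = (y *m M) 0 a.
  by rewrite LE linear_form_eval mxE; apply: eq_bigr => b _; rewrite mulrC.
have uM : M \in unitmx.
  rewrite unitmxE unitfE; apply/negP => /det0P[y y0 yM].
  have [r yr] : exists r, y 0 r != 0.
    apply: boolp.contrapT => /boolp.forallNP ny; move/eqP: y0; apply.
    by apply/rowP => l; rewrite [RHS]mxE; apply/eqP/negPn/negP/ny.
  have [x [c [c0 xy]]] := exists_proj_point yr.
  have on a : on_curve (eqn B (L a)) x by rewrite (on_curve_scale _ c0 xy) ev yM mxE.
  have := noc x; rewrite (on 0) (on 1).
  by have := on (inord 2); rewrite /L /= inordK // => ->.
exists L, (fun a k => invmx M a k); split=> //.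
- move=> a b /eqP; rewrite nth_uniq ?ltn_ord // => /eqP ab; exact: val_inj.
- move=> l; rewrite (eq_bigr (fun a => \sum_b (M b a * invmx M a l) *: 'X_b)) => [|a _].
    rewrite exchange_big /= (eq_bigr (fun b => (b == l)%:R *: 'X_b)) => [|b _].
      by rewrite (bigD1 l) //= eqxx scale1r big1 ?addr0 // => b bl; rewrite (negPf bl) scale0r.
    rewrite -scaler_suml; congr (_ *: _).
    by have /matrixP/(_ b l) := mulmxV uM; rewrite !mxE.
  by rewrite LE /linear_form scaler_sumr; apply: eq_bigr => b _; rewrite scalerA mulrC.
- move=> b a; have -> : (eqn B (L a)).@[fun k0 => invmx M b k0] =
      (eqn B (L a)).@[(row b (invmx M)) 0].
    by apply: meval_eq => l; rewrite mxE.
  rewrite ev -row_mul mulVmx //.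
  by rewrite !mxE.
Qed.

End Lines.

(** * Tropical weights lie in the fan *)

Section TropInFan.
Variables (K : closedFieldType) (R : realType) (n : nat) (B : arrangement K n).
Hypothesis htr : transverse B.
Variables (L : 'I_3 -> 'I_n) (P : 'I_3 -> 'I_3 -> K).
Hypothesis XE : forall k, 'X_k = \sum_a P a k *: eqn B (L a).
Variable v : 'rV[R]_n.
Hypothesis tropv : trop_complement B (N_class (deg B) v).
Hypothesis vL : forall a, 0 <= v 0 (L a).
Variable a0 : 'I_3.
Hypothesis va0 : v 0 (L a0) = 0.

Lemma filtered_eqn i : filtered B v (v 0 i) (eqn B i).
Proof. by rewrite -curve_monomialU; apply: filtered_monomial; rewrite weightU. Qed.

Lemma filtered_const c : filtered B v 0 c%:MP.
Proof.
rewrite -[X in filtered _ _ _ X]mulr1 mul_mpolyC -[X in filtered _ _ _ X]addr0.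
rewrite -(curve_monomial0 B); apply: filtered_cons; last exact: filtered0.
by rewrite weight0.
Qed.

(** The coordinates are combinations of the three lines, whose weights are nonnegative. *)
Lemma filtered_all f : filtered B v 0 f.
Proof.
elim/mpoly_ring_ind: f => [c|k|p q|p q Fp Fq]; first exact: filtered_const.
- rewrite XE; apply: (big_ind (filtered B v 0)).
  + exact: filtered0.
  + exact: filteredD.
  + move=> a _; rewrite -mul_mpolyC -[0]addr0; apply: filteredM.
      exact: filtered_const.
    exact: filteredW (filtered_eqn _).
- exact: filteredD.
- by rewrite -[0]addr0; apply: filteredM.
Qed.

Lemma filteredMl theta f g : filtered B v theta g -> filtered B v theta (f * g).
Proof. by move=> Fg; rewrite -[theta]add0r; apply: filteredM => //; apply: filtered_all. Qed.

Lemma weight_ge0 i : 0 <= v 0 i.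
Proof.
rewrite -(weightU v); apply: (trop_weight_le tropv).
exact: filtered_all.
Qed.

Let Z : {set 'I_n} := [set i | 0 < v 0 i].

Let outZ : 'X_{1..n} := [multinom (i \notin Z : nat) | i < n].

Lemma weight_outZ k : weight v (outZ *+ k)%MM = 0.
Proof.
apply: big1 => i _; rewrite mulmnE mnmE inE.
have [_|vi] := ltP 0 (v 0 i); first by rewrite mul0n mul0r.
have -> : v 0 i = 0 by apply/le_anti; rewrite vi weight_ge0.
by rewrite mulr0.
Qed.

Lemma curve_monomialXn m k : curve_monomial B (m *+ k)%MM = curve_monomial B m ^+ k.
Proof.
elim: k => [|k IH]; first by rewrite mulm0n curve_monomial0.
by rewrite mulmS curve_monomialD IH exprS.
Qed.

Definition above (theta : R) (h : {mpoly K[3]}) : Prop :=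
  exists2 theta', theta < theta' & filtered B v theta' h.

Lemma above_ideal theta (f : {mpoly K[3]}) : ideal_pred (fun h => above theta (f * h)).
Proof.
split=> [|g h [t1 lt1 F1] [t2 lt2 F2]|g h [t ltt F]].
- by exists (theta + 1); [rewrite ltrDl | rewrite mulr0; apply: filtered0].
- exists (Num.min t1 t2); first by rewrite lt_min lt1.
  rewrite mulrDr; apply: filteredD; first by apply: filteredW F1; rewrite ge_min lexx.
  by apply: filteredW F2; rewrite ge_min lexx orbT.
- by exists t => //; rewrite mulrCA; apply: filteredMl.
Qed.

(** The ideal of all [h] whose product with the monomial of [m0] has level above [weight v m0]
    contains the equations of [Z], but no power of the product of the others, which has weight 0.
    The case [m0 = 0] gives the point itself, [m0 = U_(k)] serves [weight_ultrametric]. *)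
Lemma exists_center m0 : exists x,
  curves_through B x = Z /\
  forall e h, h \is e.-homog -> above (weight v m0) (curve_monomial B m0 * h) ->
    h.@[hcoord x] = 0.
Proof.
have [|y [yI yF]] := nullstellensatz3 (F := curve_monomial B outZ)
    (above_ideal (weight v m0) (curve_monomial B m0)).
  move=> k [t ltt]; rewrite -curve_monomialXn -curve_monomialD.
  move/(trop_weight_le tropv); rewrite weightD weight_outZ addr0.
  by rewrite leNgt ltt.
have yout i : i \notin Z -> (eqn B i).@[y] != 0.
  move=> iZ; apply: contraNneq yF => iy; rewrite rmorph_prod (bigD1 i) //= rmorphXn.
  by rewrite mnmE iZ expr1 /= iy mul0r.
(* The line of weight 0 does not vanish at [y], so [y] is not the origin and defines a point of the
   plane. *)
have nZa0 : L a0 \notin Z by rewrite inE va0 ltxx.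
have [x [c [c0 xy]]] := eqn_neq0_point (yout _ nZa0).
exists x; split=> [|e h hh hI]; last first.
  by rewrite (meval_homog_scale hh xy) yI ?mulr0.
apply/setP => i; rewrite inE (on_curve_scale B i c0 xy).
have [iZ|/yout/negPf //] := boolP (i \in Z).
apply/eqP/yI; exists (weight v m0 + v 0 i); first by rewrite ltrDl; rewrite inE in iZ.
by apply: filteredM; [exact: filtered_monomial | exact: filtered_eqn].
Qed.

Lemma weight_ultrametric i j k : i \in Z -> j \in Z -> k \in Z -> i != j ->
  Num.min (v 0 i) (v 0 j) <= v 0 k.
Proof.
move=> iZ jZ kZ ij; rewrite leNgt; apply/negP; rewrite lt_min => /andP[ki kj].
have [x [xZ xJ]] := exists_center U_(k)%MM.
rewrite curve_monomialU weightU in xJ.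
have on l : l \in Z -> (eqn B l).@[hcoord x] = 0.
  by rewrite -xZ inE => /eqP.
have mult : intersection_multiplicity x (eqn B i) (eqn B j) 1.
  by apply: htr => //; apply/eqP/on.
have [S [A [C [[S0 [d hS]] E]]]] :=
  vanishing_in_ideal (on _ iZ) (on _ jZ) mult (eqn_homog B k) (on _ kZ).
(* [S] times the equation of [k] has level at least the minimum of the weights of [i] and [j], which
   exceeds that of [k]; hence [S] would vanish at [x]. *)
move/eqP: S0; apply; apply: (xJ d) => //.
exists (Num.min (v 0 i) (v 0 j)); first by rewrite lt_min ki.
rewrite mulrC E; apply: filteredD; apply: filteredMl.
  by apply: filteredW (filtered_eqn i); rewrite ge_min lexx.
by apply: filteredW (filtered_eqn j); rewrite ge_min lexx orbT.
Qed.

Lemma normalized_trop_in_fan :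
  fan_support (arroid_fan (transversal_arroid B)) (N_class (deg B) v).
Proof.
have v0 i : i \notin Z -> v 0 i = 0.
  by rewrite inE -leNgt => vi; apply/le_anti; rewrite vi weight_ge0.
have [Z0|[i1 iZ1]] := set_0Vmem Z.
  exists (fun w => w = N_class (deg B) 0); first exact: Fan_origin.
  by congr N_class; apply/rowP => i; rewrite [RHS]mxE v0 // Z0 inE.
case: (@Order.TotalTheory.arg_maxP _ _ _ i1 (mem Z) (fun i => v 0 i) iZ1) => i iZ imax.
case: (@Order.TotalTheory.arg_minP _ _ _ i1 (mem Z) (fun i => v 0 i) iZ1) => j jZ jmin.
have {}iZ : i \in Z := iZ.
(* The ultrametric inequality for [k], [i] against [j]: as [i] has the largest weight, the weight of
   [k] is at most that of [j]. *)
have vk k : k \in Z -> k != i -> v 0 k = v 0 j.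
  move=> kZ ki; apply/le_anti; rewrite (jmin k kZ) andbT.
  have := weight_ultrametric kZ iZ jZ ki.
  by rewrite ge_min => /orP[//|]; apply: le_trans; apply: imax.
have vE : v = (v 0 i - v 0 j) *: unit_vec R i + v 0 j *: point_vec R Z.
  apply/rowP => k; rewrite !mxE summxE.
  rewrite (eq_bigr (fun l => (k == l)%:R)) => [|l _]; last by rewrite mxE.
  have [kZ|kZ] := boolP (k \in Z).
    rewrite (bigD1 k) //= eqxx big1 ?addr0 => [|l /andP[_ lk]]; last first.
      by rewrite eq_sym (negPf lk).
    have [->|ki] := eqVneq k i; first by rewrite !mulr1 subrK.
    by rewrite mulr0 add0r mulr1 vk.
  rewrite v0 // big1 => [|l lZ]; last first.
    by have [kl|] := eqVneq k l; first by rewrite kl lZ in kZ.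
  have [ki|_] := eqVneq k i; first by rewrite ki iZ in kZ.
  by rewrite !mulr0 addr0.
(* Two or more curves in [Z] meet in a point of the arroid; for a single curve [v] lies on its
   ray. *)
have [Z2|Z2] := leqP 2 #|Z|.
  exists (cone2 (unit_vec R i) (point_vec R Z)); last first.
    exists (v 0 i - v 0 j), (v 0 j); split; [|exact: weight_ge0|by rewrite -vE].
    by rewrite subr_ge0 jmin.
  apply: (@Fan_cone R n (transversal_arroid B)) => //.
  have [x [xZ _]] := exists_center 0%MM.
  have x2 : (2 <= #|curves_through B x|)%N by rewrite xZ.
  by exists (exist (fun x => is_true (2 <= #|curves_through B x|)%N) x x2).
exists (cone1 (unit_vec R i)); first exact: (@Fan_ray R n (transversal_arroid B)).
exists (v 0 i); first exact: weight_ge0.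
congr N_class; apply/rowP => k; rewrite !mxE eqxx /=.
have [->|ki] := eqVneq k i; first by rewrite mulr1.
rewrite mulr0 v0 //; apply/negP => kZ; move: Z2; rewrite ltnS leqNgt => /negP; apply.
by rewrite (cardD1 i) iZ (cardD1 k) !inE ki; rewrite inE in kZ; rewrite kZ.
Qed.

End TropInFan.

(** * Weights in the fan are tropical *)

(* Scale (s, t) by a large integer and round up. *)
Lemma positive_integer_weights (R : realType) (s t : R) (l : seq (int * int)) :
    0 <= s -> 0 <= t ->
    (forall p, p \in l -> 0 < s * p.1%:~R + t * p.2%:~R) ->
  exists S T : nat, [/\ (0 < S)%N, (0 < T)%N &
    forall p, p \in l -> 0 < S%:Z * p.1 + T%:Z * p.2].
Proof.
(* Rounding changes the value at [p] by at most [|p.1| + |p.2|]; [N] makes the scaled values exceed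
   this on the whole finite list. *)
move=> s0 t0 pos.
have [N hN] : exists N : nat, forall k, (N <= k)%N -> forall p, p \in l ->
    `|p.1|%:~R + `|p.2|%:~R < k%:R * (s * p.1%:~R + t * p.2%:~R).
  elim: l pos => [|p l IH] pos; first by exists 0%N.
  have [|N hN] := IH; first by move=> q ql; apply: pos; rewrite inE ql orbT.
  have p0 := pos p (mem_head _ _).
  pose y := (`|p.1|%:~R + `|p.2|%:~R) / (s * p.1%:~R + t * p.2%:~R).
  have y0 : 0 <= y by rewrite divr_ge0 ?(ltW p0) // addr_ge0 // ler0z.
  exists (maxn N (Num.truncn y).+1) => k; rewrite geq_max => /andP[Nk yk] q.
  rewrite inE => /orP[/eqP ->|]; last exact: hN.
  rewrite -ltr_pdivrMr // -/y; have /andP[_ yt] := truncn_itv y0.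
  by apply: lt_le_trans yt _; rewrite ler_nat.
(* Floor plus one, so that both integers are positive even if [s] or [t] is 0. *)
exists (Num.truncn (N%:R * s)).+1, (Num.truncn (N%:R * t)).+1; split=> // p pl.
have := hN N (leqnn N) p pl.
have /truncn_itv : 0 <= N%:R * s by rewrite mulr_ge0.
have /truncn_itv : 0 <= N%:R * t by rewrite mulr_ge0.
move: (Num.truncn _) (Num.truncn _) => S T /andP[T1 T2] /andP[S1 S2] hp.
rewrite -(ltr0z R) rmorphD !rmorphM /=.
have round (y z : R) m : m%:R <= y -> y < m.+1%:R -> - `|z| <= (m.+1%:R - y) * z.
  rewrite -natr1 => my ym; have [z0|z0] := leP 0 z.
    by apply: (@le_trans _ _ 0); rewrite ?oppr_le0 // mulr_ge0 //; lra.
  by rewrite ltr0_norm // opprK -[leLHS]mul1r ler_nM2r //; lra.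
have := round _ p.1%:~R _ S1 S2; have := round _ p.2%:~R _ T1 T2.
by rewrite -!intr_norm; nra.
Qed.

Lemma min_attained_twice_or (K : fieldType) (R : realType) (M : choiceType)
    (w : M -> R) (g : {freeg M / K}) :
  min_attained_twice (trivial_valuation K R) w g \/
  exists2 a, a \in dom g & forall b, b \in dom g -> b != a -> w a < w b.
Proof.
have [->|g0] := eqVneq g 0; first by left; left.
have [a ag amin] : exists2 a, a \in dom g & forall b, b \in dom g -> w a <= w b.
  have : dom g != [::] by rewrite dom_eq0.
  elim: (dom g) => // a s IH _; have [->|s0] := eqVneq s [::].
    by exists a; rewrite ?mem_head // => b; rewrite inE => /eqP ->.
  have [b bs bmin] := IH s0; have [ab|ba] := leP (w a) (w b).
    exists a; rewrite ?mem_head // => c; rewrite inE => /orP[/eqP -> //|/bmin].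
    exact: le_trans.
  exists b; first by rewrite inE bs orbT.
  by move=> c; rewrite inE => /orP[/eqP ->|/bmin //]; apply: ltW.
have [uniqa|] := boolp.pselect (forall b, b \in dom g -> b != a -> w a < w b).
  by right; exists a.
move=> /boolp.existsNP[b /boolp.not_implyP[bg /boolp.not_implyP[ba /negP]]].
rewrite -leNgt => wba; left; right; exists a, b; rewrite /trivial_valuation !add0r.
split=> //; first by rewrite eq_sym.
  by apply/le_anti; rewrite wba amin.
by move=> c cg; rewrite add0r amin.
Qed.

Section FanInTrop.
Variables (K : closedFieldType) (n : nat) (B : arrangement K n).

(** Restrict the equation to a coordinate line other than [i], in its two affine charts. Without a
    root both restrictions are nonzero constants [q] and [p] with [q = y ^+ deg B i * p] for all
    nonzero [y], which fails for some [y]. *)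
Lemma curve_meets_line (L : 'I_3 -> 'I_n) (P : 'I_3 -> 'I_3 -> K) i :
    injective L -> (forall a, deg B (L a) = 1%N) ->
    (forall b a, (eqn B (L a)).@[P b] = (b == a)%:R) ->
  exists2 x, i \in curves_through B x & (2 <= #|curves_through B x|)%N.
Proof.
move=> Linj dL LP.
have [a ai] : exists a, L a != i.
  have [L0|L0] := eqVneq (L 0) i; last by exists 0.
  by exists 1; rewrite -L0 (inj_eq Linj).
have [b [c [ba ca bc]]] : exists b c, [/\ b != a, c != a & b != c].
  case: a {ai} => [[|[|[|//]]] lta].
  - by exists 1, (inord 2); split; rewrite -val_eqE /= ?inordK.
  - by exists 0, (inord 2); split; rewrite -val_eqE /= ?inordK.
  - by exists 0, 1; split.
have line d (p q : 'I_3 -> K) y : (eqn B (L d)).@[fun k => p k + y * q k] =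
    (eqn B (L d)).@[p] + y * (eqn B (L d)).@[q].
  have := eqn_homog B (L d); rewrite dL => /homog1_linear_form ->.
  rewrite !linear_form_eval mulr_sumr -big_split; apply: eq_bigr => k _ /=.
  by rewrite mulrDr mulrCA.
have root_case b' c' y : b' != a -> c' != a -> b' != c' ->
    (eqn B i).@[fun k => P b' k + y * P c' k] = 0 ->
    exists2 x, i \in curves_through B x & (2 <= #|curves_through B x|)%N.
  move=> ba' ca' bc' iy; set z := fun k => _ in iy.
  have zb : (eqn B (L b')).@[z] != 0.
    by rewrite line !LP eqxx [c' == _]eq_sym (negPf bc') mulr0 addr0 oner_eq0.
  have za : (eqn B (L a)).@[z] = 0.
    by rewrite line !LP (negPf ba') (negPf ca') mulr0 addr0.
  have [x [e [e0 xz]]] := eqn_neq0_point zb.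
  have xi : i \in curves_through B x by rewrite inE (on_curve_scale B _ e0 xz) iy.
  have xa : L a \in curves_through B x by rewrite inE (on_curve_scale B _ e0 xz) za.
  exists x => //; apply: (@leq_trans #|[set i; L a]|); first by rewrite cards2 eq_sym ai.
  by apply/subset_leq_card/subsetP => k; rewrite !inE => /orP[/eqP ->|/eqP ->];
     [move: xi | move: xa]; rewrite inE.
pose gamma b' c' := along (fun k => (P b' k)%:P + 'X * (P c' k)%:P) (eqn B i).
have gammaE b' c' y : (gamma b' c').[y] = (eqn B i).@[fun k => P b' k + y * P c' k].
  rewrite along_horner; apply: meval_eq => k.
  by rewrite hornerD hornerM hornerX !hornerC.
have [/closed_rootP[y /rootP]|] := boolP (size (gamma b c) != 1%N).
  by rewrite gammaE; apply: (root_case _ _ _ ba ca bc).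
have cb : c != b by rewrite eq_sym.
have [/closed_rootP[y /rootP]|] := boolP (size (gamma c b) != 1%N).
  by rewrite gammaE => /(root_case _ _ _ ca ba cb).
move=> /negPn/size_poly1P[p p0 pE] /negPn/size_poly1P[q q0 qE].
have qp y : y != 0 -> q = y ^+ deg B i * p.
  move=> y0; have := gammaE b c y; rewrite qE hornerC => ->.
  have := gammaE c b y^-1; rewrite pE hornerC => ->.
  apply: meval_homog_scale (eqn_homog B i) _ => k.
  by rewrite mulrDr mulVKf // addrC.
have /closed_nonrootP[y] : ('X * ('X^(deg B i) - 1) : {poly K}) != 0.
  by rewrite mulf_neq0 ?polyX_eq0 // -size_poly_eq0 size_XnsubC ?deg_gt0.
rewrite rootE hornerM hornerX hornerD hornerN hornerXn hornerC mulf_eq0 negb_or.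
move=> /andP[y0]; rewrite subr_eq0 => /eqP[]; apply: (mulIf p0).
by rewrite -qp // mul1r (qp 1) ?oner_eq0 // expr1n mul1r.
Qed.

(** The coordinates of [S e_i + T v_p], realized as contact orders of an arc with the curves. *)
Definition arc_order (p : {set 'I_n}) i S T (j : 'I_n) : nat :=
  (j \in p) * T + (j == i) * S.

Lemma exists_arc x i S T : transverse B -> i \in curves_through B x ->
    (2 <= #|curves_through B x|)%N -> (0 < S)%N -> (0 < T)%N ->
  exists (gamma : 'I_3 -> {poly K}) (q : 'I_n -> {poly K}), forall j,
    along gamma (eqn B j) = 'X^(arc_order (curves_through B x) i S T j) * q j /\
    (q j).[0] != 0.
Proof.
move=> htr xi x2 S0 T0.
have [j0 j0i xj0] : exists2 j0, j0 != i & j0 \in curves_through B x.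
  move: x2; rewrite (cardD1 i) xi ltnS => /card_gt0P[j0].
  by rewrite !inE => /andP[ji xj]; exists j0; rewrite ?inE.
have [v [u [iv iu jv]]] := tangent_frame htr xi xj0 j0i.
have ix : (eqn B i).@[hcoord x] = 0 by move: xi; rewrite inE => /eqP.
(* The order [T.+1 + S.-1] equals [S + T], as [S] is positive. *)
have [h [qi [iE qi0]]] := exists_tangent_arc S.-1 T0 ix iv iu.
exists (arc (hcoord x) v u T h).
suff qP j : exists q : {poly K}, along (arc (hcoord x) v u T h) (eqn B j) =
    'X^(arc_order (curves_through B x) i S T j) * q /\ q.[0] != 0.
  by exists (fun j => projT1 (boolp.cid (qP j))) => j; case: (boolp.cid (qP j)).
rewrite /arc_order; have [->|ji] := eqVneq j i.
  by exists qi; rewrite xi !mul1n iE addSn -addnS prednK.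
have [xj|xj] := boolP (j \in _).
  rewrite mul1n addn0; apply: along_arc_transverse => //; last exact: jv.
  by move: xj; rewrite inE => /eqP.
exists (along (arc (hcoord x) v u T h) (eqn B j)); rewrite mul1r; split=> //.
rewrite along_horner (meval_eq _ (v2 := hcoord x)); last by move=> k; apply: arc0.
by move: xj; rewrite inE.
Qed.

(** The Laurent relation times the [N]-th powers of all equations, restricted to the arc. If it were
    not 0, some parameter would avoid its roots and all the curves, giving a point of the complement
    where the relation fails. *)
Lemma along_relation gamma (N : nat) (g : {freeg (M_lattice (deg B)) / K})
    (e : M_lattice (deg B) -> 'I_n -> nat) (L0 : 'I_n) :
    (forall b j, b \in dom g -> val b 0 j + N%:Z = e b j) ->
    vanishes_on (embedded_complement B) g ->
    (forall j, along gamma (eqn B j) != 0) ->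
  \sum_(b <- dom g) coeff b g *: \prod_j along gamma (eqn B j) ^+ e b j = 0.
Proof.
move=> eE gB nz; set G := (X in X = 0).
apply/eqP/negPn/negP => G0.
have /closed_nonrootP[y] : G * \prod_j along gamma (eqn B j) != 0.
  by rewrite mulf_neq0 //; apply/prodf_neq0.
rewrite rootE hornerM mulf_eq0 negb_or horner_prod => /andP[Gy /prodf_neq0 fy].
pose z k := (gamma k).[y].
have fz j : (along gamma (eqn B j)).[y] = (eqn B j).@[z] by rewrite along_horner.
have z0 j : (eqn B j).@[z] != 0 by rewrite -fz; apply: fy.
have [x [c [c0 xz]]] := eqn_neq0_point (z0 L0).
have xB : in_complement B x by move=> j; rewrite (on_curve_scale B j c0 xz).
have := gB _ (ex_intro2 _ _ x xB erefl); set ev := (X in X = 0) => ev0.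
move/eqP: Gy; apply; rewrite -[RHS](mul0r (\prod_j (eqn B j).@[z] ^+ N)) -ev0.
rewrite /ev /G horner_sum mulr_suml; apply: eq_big_seq => b bg.
rewrite hornerZ -mulrA; congr (_ * _); rewrite horner_prod.
(* The scalar [c] between the two coordinate vectors cancels, since the character has degree 0. *)
have -> : intrinsic_embedding B x b = \prod_j (eqn B j).@[z] ^ (val b 0 j).
  rewrite /intrinsic_embedding.
  rewrite (eq_bigr (fun j =>
    c ^ (val b 0 j * (deg B j)%:Z) * (eqn B j).@[z] ^ (val b 0 j))).
    rewrite big_split /= -(big_morph (exprz c) (fun m n => expfzDr m n c0) (expr0z c)).
    by rewrite (eqP (valP b)) expr0z mul1r.
  move=> j _; rewrite (meval_homog_scale (eqn_homog B j) xz).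
  by rewrite expfzMl [c ^+ _]exprnP exprz_exp [X in c ^ X]mulrC.
rewrite -big_split; apply: eq_bigr => j _ /=.
by rewrite horner_exp fz !exprnP -eE // expfzDr.
Qed.

Lemma fan_cone_in_trop (R : realType) x i (s t : R) : transverse B ->
    i \in curves_through B x -> (2 <= #|curves_through B x|)%N ->
    0 <= s -> 0 <= t ->
  trop_complement B
    (N_class (deg B) (s *: unit_vec R i + t *: point_vec R (curves_through B x))).
Proof.
move=> htr xi x2 s0 t0 g gB; set p := curves_through B x.
set w := pairing _.
have [//|[a0 a0g amin]] := min_attained_twice_or w g.
pose alpha (a : M_lattice (deg B)) : int := val a 0 i.
pose beta (a : M_lattice (deg B)) : int := \sum_(j in p) val a 0 j.
have delta_sum (S : comNzRingType) (F : 'I_n -> S) : \sum_j (j == i)%:R * F j = F i.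
  rewrite (bigD1 i) //= eqxx mul1r big1 ?addr0 // => j ji.
  by rewrite (negPf ji) mul0r.
have mem_sum (S : comNzRingType) (F : 'I_n -> S) :
    \sum_j (j \in p)%:R * F j = \sum_(j in p) F j.
  rewrite [RHS]big_mkcond; apply: eq_bigr => j _.
  by case: (j \in p); rewrite ?mul1r ?mul0r.
have wE a : w a = s * (alpha a)%:~R + t * (beta a)%:~R.
  rewrite /w pairing_class /beta rmorph_sum -mem_sum /alpha.
  rewrite -(delta_sum _ (fun j => (val a 0 j)%:~R)) !mulr_sumr -big_split.
  apply: eq_bigr => j _; rewrite !mxE summxE eqxx /=.
  have -> : \sum_(k in p) unit_vec R k 0 j = (j \in p)%:R.
    rewrite -mem_sum (bigD1 j) //= mxE !eqxx mulr1 big1 ?addr0 // => k kj.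
    by rewrite mxE [j == k]eq_sym (negPf kj) andbF mulr0.
  by ring.
(* These differences encode that [a0] is the only minimum, a condition that survives for suitable
   positive integers in place of [s] and [t]. *)
pose l := [seq (alpha b - alpha a0, beta b - beta a0) | b <- dom g & b != a0].
have [|S [T [S0 T0 ST]]] := @positive_integer_weights R s t l s0 t0.
  move=> r /mapP[b]; rewrite mem_filter => /andP[ba bg] -> {r}.
  have := amin b bg ba; rewrite !wE /= !rmorphB /= -subr_gt0.
  by congr (_ < _); ring.
have [gamma [q gE]] := exists_arc htr xi x2 S0 T0.
(* A bound on the absolute values of all exponents in [g], so that every shifted exponent is
   nonnegative. *)
pose N : nat := \sum_(b <- dom g) \sum_j absz (val b ord0 j).
pose e (b : M_lattice (deg B)) j : nat := absz (val b ord0 j + N%:Z).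
have eE b j : b \in dom g -> val b 0 j + N%:Z = e b j.
  have : b \in dom g -> (absz (val b ord0 j) <= N)%N.
    by move=> bg; rewrite /N (big_rem b) //= (bigD1 j) //= -addnA leq_addr.
  by move=> bN /bN; rewrite /e -[val b 0 j]/(val b ord0 j); lia.
have nz j : along gamma (eqn B j) != 0.
  have [-> qj] := gE j; rewrite mulf_neq0 -?size_poly_eq0 ?size_polyXn //.
  by rewrite size_poly_eq0; apply: contraNneq qj => ->; rewrite horner0.
(* Compare coefficients at the order of the term of [a0], which all other terms exceed; that
   coefficient cannot be 0. *)
have /(congr1 (fun f : {poly K} => f`_(\sum_j arc_order p i S T j * e a0 j))) :=
  along_relation i eE gB nz.
pose E b := (\sum_j arc_order p i S T j * e b j)%N.
have termE b : \prod_j along gamma (eqn B j) ^+ e b j = 'X^(E b) * \prod_j q j ^+ e b j.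
  rewrite /E -prodrXr -big_split; apply: eq_bigr => j _ /=.
  by have [-> _] := gE j; rewrite exprMn exprM.
have Elt b : b \in dom g -> b != a0 -> (E a0 < E b)%N.
  move=> bg ba; have := ST _ (map_f _ (_ : b \in [seq b <- dom g | b != a0])).
  rewrite mem_filter ba => /(_ bg) /=.
  (* Up to a constant independent of [c], the order is the pairing of [c] with [S e_i + T v_p]. *)
  have EZ c : c \in dom g -> (E c)%:Z = S%:Z * alpha c + T%:Z * beta c +
      \sum_j (arc_order p i S T j)%:Z * N%:Z.
    move=> cg; rewrite /E (big_morph Posz PoszD (erefl _)).
    rewrite /alpha /beta -mem_sum -(delta_sum _ (fun j => val c 0 j)).
    rewrite !mulr_sumr -!big_split; apply: eq_bigr => j _ /=.
    rewrite PoszM -eE // mulrDr; congr (_ + _); rewrite /arc_order PoszD !PoszM.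
    by rewrite -!natz; ring.
  by have := EZ b bg; have := EZ a0 a0g; lia.
rewrite coef0 coef_sum (bigD1_seq a0) ?uniq_dom //=.
rewrite [X in _ + X]big1_seq => [|b /andP[ba bg]]; last first.
  by rewrite coefZ termE coefXnM -/(E a0) Elt ?mulr0.
rewrite addr0 coefZ termE coefXnM ltnn subnn -horner_coef0 horner_prod => /eqP.
rewrite mulf_eq0 => /orP[|/prodf_eq0[j _]].
  by move: a0g; rewrite mem_dom => /negPf ->.
by rewrite horner_exp expf_eq0; have [_ /negPf ->] := gE j; rewrite andbF.
Qed.

End FanInTrop.

(** * Normalization of the weight and reduction to the two-dimensional cones *)

Theorem theorem4p15 (K : closedFieldType) (R : realType) (n : nat)
    (B : arrangement K n) (hva : very_affine B) (htr : transverse B)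
    (w : N_space R (deg B)) :
  trop_complement B w <->
  fan_support (arroid_fan (transversal_arroid B)) w.
Proof.
have [L [P [Linj dL XE LP]]] := coordinate_lines hva.
split=> [tropw|[C fanC Cw]].
  pose u : 'rV[R]_n := repr w.
  have wu : w = N_class (deg B) u by rewrite /N_class reprK.
  have [a0 _ amin] := @Order.TotalTheory.arg_minP _ _ _ (0 : 'I_3) predT
    (fun a => u 0 (L a)) isT.
  (* The coordinate lines have degree 1, so this shift gives the lightest of them weight 0 and keeps
     the class. *)
  pose v := u - u 0 (L a0) *: \row_i (deg B i)%:R.
  have vL a : v 0 (L a) = u 0 (L a) - u 0 (L a0) by rewrite !mxE dL mulr1.
  have wv : w = N_class (deg B) v.
    by rewrite wu; apply/N_class_eqP; exists (u 0 (L a0)); rewrite opprB addrC subrK.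
  rewrite wv in tropw *.
  have vL0 a : 0 <= v 0 (L a) by rewrite vL subr_ge0; apply: amin.
  apply: (normalized_trop_in_fan htr XE tropw vL0 (a0 := a0)).
  by rewrite vL subrr.
(* Every curve contains a point of the arroid, so the origin and the rays are covered by cones with
   a coefficient 0. *)
have meet i := curve_meets_line i Linj dL LP.
have cone x i s t : i \in curves_through B x -> (2 <= #|curves_through B x|)%N ->
    0 <= s -> 0 <= t -> w = N_class (deg B)
      (s *: unit_vec R i + t *: point_vec R (curves_through B x)) ->
    trop_complement B w.
  by move=> xi x2 s0 t0 ->; apply: fan_cone_in_trop.
case: fanC Cw => [wE|i [s s0 wE]|_ [[x x2] <-] [t t0 wE]|
  i _ [[x x2] <-] xi [s [t [s0 t0 wE]]]].
- have [x xi x2] := meet (L 0).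
  by apply: (cone x (L 0) 0 0) => //; rewrite !scale0r addr0.
- have [x xi x2] := meet i.
  by apply: (cone x i s 0) => //; rewrite scale0r addr0.
- have /card_gt0P[i xi] : (0 < #|curves_through B x|)%N by apply: ltnW.
  by apply: (cone x i 0 t) => //; rewrite scale0r add0r.
- exact: (cone x i s t).
Qed.
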